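(* Let $q$ be a positive integer, let $k\ge 1$ be an integer, let $\sigma\ge 1$ be real and let $X\ge 1$. Then \[ 0\le \sum_{\substack{n\le X\\ (n,q)=1}}\frac{\mu(n)}{n^{\sigma}}\log^k\Bigl(\frac{X}{n}\Bigr)\le 1.00303\,\frac{q}{\varphi(q)}\bigl(k+(\sigma-1)\log X\bigr)(\log X)^{k-1}. \] Moreover, when $k\neq 1$, the constant $1.00303$ may be replaced by $1$.
   Context: $\mu$ is the Möbius function and $\varphi$ is Euler's totient function. *)

(* Defs.v *)
From HB Require Import structures.
From mathcomp Require Import all_boot all_order all_algebra.
From mathcomp Require Import all_classical all_reals all_analysis.

Set Implicit Arguments.
Unset Strict Implicit.
Unset Printing Implicit Defensive.

Import Order.TTheory GRing.Theory Num.Theory.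

Local Open Scope ring_scope.

Definition squarefree (n : nat) : bool :=
  (0 < n)%N && all (fun p => logn p n == 1%N) (primes n).

(* [primes n] has no repetitions, so its size is the number of distinct
   prime factors of n; moebius 0 = 0 by convention. *)
Definition moebius (n : nat) : int :=
  if squarefree n then (-1) ^+ size (primes n) else 0.

(* [Num.truncn X] is the integer part of X when X >= 0. *)
Definition moebius_log_sum (R : realType) (q k : nat) (sigma X : R) : R :=
  \sum_(1 <= n < (Num.truncn X).+1 | coprime n q)
     (moebius n)%:~R / (n%:R `^ sigma) * ln (X / n%:R) ^+ k.

(* Main.v *)
Require Import Defs.
From Stdlib Require Import ZArith.
From HB Require Import structures.
From mathcomp Require Import all_boot all_order all_algebra.
From mathcomp Require Import all_classical all_reals all_analysis.
From mathcomp Require Import zify ssrZ ring lra.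
From mathcomp Require polyrcf.

(** Write M(X) for the sum and L(x) for the case q = k = sigma = 1.

    The conditions on q are removed prime by prime: adding p to the set of
    excluded primes gives M_{qp}(X) = M_q(X) + p^(-sigma) M_{qp}(X/p), and iterating
    costs at most the factor p/(p-1); these factors multiply to q/phi(q).
    The exponent is removed by expanding the exponential in
    n^(1-sigma) = X^(1-sigma) exp((sigma-1) log(X/n)), all coefficients being
    nonnegative. Between integers M is differentiable in log X with derivative k times
    the sum for k-1, so k >= 3 follows from k = 2, and nonnegativity from k = 1. For
    k = 2 invert the expansion of sum_{m <= t} log(t/m)/m, which is
    log^2(t)/2 + g log t + c + O(1/t^2).

    The core is L(x) <= 1.00303, whose maximum is near x = 30. Below 8 N, where
    N = 1119, L is tabulated in fixed-point arithmetic. Beyond, let L_N(u) be L(u) for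
    u < N and L(N) for u >= N. Then L(x) - L(N) = sum_{n <= x} mu(n)/n E(x/n), where
    E(t) = log t - sum_{m <= t} L_N(t/m)/m. This vanishes for t < N, and is bounded for
    t < 8 N by the table, which bounds |L - L(N)| on [N, 8 N). For t >= 8 N the expansion
    gives E(t) as an affine function of log t with tiny coefficients plus O(1/t^2);
    the sum of the affine part is controlled by |sum mu(n)/n| <= 1 and by the bound
    for L(x/(8 N)), which is known by induction. *)

Set Implicit Arguments.
Unset Strict Implicit.
Unset Printing Implicit Defensive.

Import Order.TTheory GRing.Theory Num.Theory.
Import numFieldNormedType.Exports.

Local Open Scope ring_scope.

(** * Möbius inversion *)

Lemma primes_pmul (p n : nat) : prime p -> (0 < n)%N -> coprime p n ->
  perm_eq (primes (p * n)) (p :: primes n).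
Proof.
move=> pp n0 cpn; have p0 := prime_gt0 pp.
apply: uniq_perm; first exact: primes_uniq.
  by rewrite /= primes_uniq andbT mem_primes pp n0 -prime_coprime.
by move=> r; rewrite primesM // (primes_prime pp) mem_seq1 in_cons.
Qed.

Lemma moebius_pmul (p n : nat) : prime p -> (0 < n)%N -> coprime p n ->
  moebius (p * n) = - moebius n.
Proof.
move=> pp n0 cpn; have P := primes_pmul pp n0 cpn.
have p0 := prime_gt0 pp.
rewrite /moebius /squarefree muln_gt0 p0 n0 /= (perm_all _ P) (perm_size P) /=.
have lpn : logn p n = 0%N.
  by apply/eqP; rewrite -leqn0 leqNgt logn_gt0 mem_primes pp n0 /= -prime_coprime// cpn.
rewrite lognM// lpn logn_prime// eqxx /= exprS mulN1r.
have -> : all (fun r => logn r (p * n) == 1%N) (primes n) =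
          all (fun r => logn r n == 1%N) (primes n).
  apply: eq_in_all => r; rewrite mem_primes => /and3P[pr _ rn].
  rewrite lognM// logn_prime//; case: (eqVneq r p) => // e; move: cpn.
  by rewrite prime_coprime// -e rn.
by case: ifP; rewrite ?oppr0.
Qed.

Lemma moebius_psqr (p n : nat) : prime p -> (0 < n)%N -> (p %| n)%N ->
  moebius (p * n) = 0.
Proof.
move=> pp n0 pn; have p0 := prime_gt0 pp.
rewrite /moebius /squarefree muln_gt0 p0 n0 /=.
case: allP => // /(_ p); rewrite mem_primes pp muln_gt0 p0 n0 dvdn_mulr//.
move=> /(_ isT); rewrite lognM// logn_prime// eqxx.
by rewrite -[X in X == _]/(_.+1) eqSS -leqn0 leqNgt logn_gt0 mem_primes pp n0 pn.
Qed.

Lemma moebius1 : moebius 1 = 1. Proof. by []. Qed.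

Lemma norm_moebius_le1 n : `|moebius n| <= 1.
Proof. by rewrite /moebius; case: ifP => _; rewrite ?normr0// normrX normrN1 expr1n. Qed.

Lemma sum_multiples (V : nmodType) (p T : nat) (P : pred nat) (f : nat -> V) : (0 < p)%N ->
  \sum_(1 <= n < T.+1 | (p %| n)%N && P n) f n
  = \sum_(1 <= m < (T %/ p).+1 | P (p * m)%N) f (p * m)%N.
Proof.
move=> p0; elim: T => [|T IH]; first by rewrite div0n !big_geq.
rewrite big_mkcond big_nat_recr//= -big_mkcond /= IH.
rewrite divnS//; case: (boolP (p %| T.+1)%N) => [/= pT|_]; last by rewrite addr0.
rewrite [in RHS]big_mkcond [in RHS]big_nat_recr//= -big_mkcond /=.
have -> : (p * (T %/ p).+1 = T.+1)%N.
  by rewrite -add1n -[1%N]/(nat_of_bool true) -pT -divnS// mulnC divnK.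
by [].
Qed.

(** Let p be the least prime factor of k. Divisors divisible by p^2 contribute nothing, and the
    remaining multiples p d of p cancel the divisors d prime to p. *)
Lemma sum_moebius_dvd k : (0 < k)%N ->
  \sum_(1 <= d < k.+1 | (d %| k)%N) moebius d = (k == 1%N)%:R.
Proof.
move=> k0; have [->|k1] := eqVneq k 1%N.
  by rewrite big_mkcond big_nat1 /= moebius1.
have pp : prime (pdiv k) by apply: pdiv_prime; case: k k0 k1 => [|[]].
set p := pdiv k in pp; have pk : (p %| k)%N := pdiv_dvd k.
have p0 := prime_gt0 pp.
rewrite (bigID (fun d => p %| d)%N) /=.
under eq_bigl do rewrite andbC.
rewrite (sum_multiples k (fun d => d %| k)%N)//.
rewrite (bigID (fun d => p %| d)%N) /= big_nat_cond big1 ?add0r; last first.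
  by move=> m /andP[/andP[m1 _] /andP[_ pm]]; exact: moebius_psqr.
have kp : (k %/ p <= k)%N := leq_div k p.
have E : \sum_(1 <= m < (k %/ p).+1 | (p * m %| k)%N && ~~ (p %| m)%N) moebius (p * m)
   = - \sum_(1 <= m < (k %/ p).+1 | (m %| k)%N && ~~ (p %| m)%N) moebius m.
  rewrite -sumrN big_nat_cond [RHS]big_nat_cond.
  apply: eq_big => [m|m /andP[/andP[m1 _] /andP[_ pm]]]; last first.
    by rewrite moebius_pmul// prime_coprime.
  case: (ltnP 0 m) => //= m0; rewrite !andbA; apply: andb_id2r => pm.
  by apply: andb_id2l => _; rewrite Gauss_dvd ?pk// prime_coprime.
(* A divisor of k prime to p divides k / p, so the range from k / p to k contributes nothing. *)
rewrite E addrC (big_cat_nat _ (n := (k %/ p).+1))//=.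
rewrite [X in _ + X - _]big_nat_cond [X in _ + X - _]big1 ?addr0 ?subrr// => m.
move=> /andP[/andP[m1 mk] /andP[mdk pm]].
suff : (m <= k %/ p)%N by rewrite leqNgt m1.
by rewrite leq_divRL// dvdn_leq// Gauss_dvd ?mdk// coprime_sym prime_coprime.
Qed.

Section DirichletSums.
Variable R : realType.
Implicit Types (x : R) (T : nat).

Lemma truncn_divn x n : 0 <= x -> (0 < n)%N ->
  Num.truncn (x / n%:R) = (Num.truncn x %/ n)%N.
Proof.
move=> x0 n0; have nR : 0 < n%:R :> R by rewrite ltr0n.
apply/eqP; rewrite eqn_leq; apply/andP; split.
  rewrite leq_divRL// truncn_ge_nat// natrM -ler_pdivlMr//.
  by rewrite truncn_le divr_ge0// ltW.
rewrite truncn_ge_nat; last by rewrite divr_ge0// ltW.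
by rewrite ler_pdivlMr// -natrM -truncn_ge_nat// leq_divM.
Qed.

Lemma sum_ltn_widen (V : nmodType) (T T' : nat) (f : nat -> V) : (T' <= T)%N ->
  \sum_(1 <= n < T'.+1) f n = \sum_(1 <= n < T.+1 | (n <= T')%N) f n.
Proof.
move=> TT; rewrite [RHS](big_cat_nat _ (n := T'.+1))//=.
rewrite [X in _ + X]big_nat_cond [X in _ + X]big1 ?addr0; last first.
  by move=> n /andP[/andP[an _] bn]; move: an; rewrite ltnNge bn.
by rewrite big_nat [RHS]big_nat_cond; apply: eq_bigl => n; rewrite ltnS; case: (n <= T')%N; rewrite ?andbT ?andbF.
Qed.

(** Both sides run over the pairs with n m <= T. *)
Lemma exchange_hyperbola (V : nmodType) T (F : nat -> nat -> V) :
  \sum_(1 <= n < T.+1) \sum_(1 <= m < (T %/ n).+1) F n m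
  = \sum_(1 <= m < T.+1) \sum_(1 <= n < (T %/ m).+1) F n m.
Proof.
under eq_bigr do rewrite (sum_ltn_widen _ (leq_div T _)).
under [RHS]eq_bigr do rewrite (sum_ltn_widen _ (leq_div T _)).
rewrite [LHS]big_nat [RHS]big_nat.
under eq_bigr => n /andP[n0 _].
  under eq_bigl => m do rewrite leq_divRL//.
  over.
under [RHS]eq_bigr => n /andP[n0 _].
  under eq_bigl => m do rewrite leq_divRL// mulnC.
  over.
rewrite -!big_nat.
under eq_bigr do rewrite big_mkcond.
by rewrite exchange_big_nat/=; under eq_bigr do rewrite -big_mkcond.
Qed.

(** The same pairs, now grouped by the product k = n m. *)
Lemma sum_dvd_hyperbola (V : nmodType) T (F : nat -> nat -> V) :
  \sum_(1 <= n < T.+1) \sum_(1 <= m < (T %/ n).+1) F n (n * m)%N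
  = \sum_(1 <= k < T.+1) \sum_(1 <= n < k.+1 | (n %| k)%N) F n k.
Proof.
transitivity (\sum_(1 <= n < T.+1) \sum_(1 <= k < T.+1 | (n %| k)%N) F n k).
  rewrite big_nat [RHS]big_nat; apply: eq_bigr => n /andP[n0 _].
  under [RHS]eq_bigl do rewrite -[(_ %| _)%N]andbT.
  by rewrite (sum_multiples T xpredT).
under eq_bigr do rewrite big_mkcond.
rewrite exchange_big_nat/= big_nat [RHS]big_nat; apply: eq_bigr => k /andP[k0 kT].
rewrite -big_mkcond [in LHS]big_mkcond [in LHS](big_cat_nat _ (n := k.+1))//=.
rewrite -big_mkcond [X in _ + X]big_nat_cond [X in _ + X]big1 ?addr0//.
move=> n /andP[/andP[kn _] _]; case: ifP => // /dvdn_leq nk.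
by move: kn; rewrite ltnNge nk.
Qed.

(** After grouping by the product, the divisor sums of the Möbius function leave only the product 1.
    The inversion formulas below and [logsum0_le1] are instances. *)
Lemma moebius_hyperbola T (H : nat -> R) : (0 < T)%N ->
  \sum_(1 <= n < T.+1) (moebius n)%:~R * \sum_(1 <= m < (T %/ n).+1) H (n * m)%N
  = H 1%N.
Proof.
move=> T0; under eq_bigr do rewrite mulr_sumr.
rewrite (sum_dvd_hyperbola T (fun n k => (moebius n)%:~R * H k)).
rewrite big_nat.
under eq_bigr => k /andP[k0 _].
  rewrite -mulr_suml -(rmorph_sum (intr : int -> R)) /= sum_moebius_dvd//.
  over.
rewrite -big_nat big_ltn// big_nat eqxx mul1r big1 ?addr0// => k /andP[k1 _].
by rewrite (gtn_eqF k1) mul0r.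
Qed.

Definition moebiusR n : R := (moebius n)%:~R.

Lemma moebiusR_norm n : `|moebiusR n| <= 1.
Proof. by rewrite /moebiusR -intr_norm -[1]/(1%:~R) ler_int norm_moebius_le1. Qed.

(** For k = 1 this is the L of the overview; for k = 0 it is the sum of mu(n)/n. *)
Definition logsum k x := \sum_(1 <= n < (Num.truncn x).+1) moebiusR n / n%:R * ln (x / n%:R) ^+ k.

(** The sum of mu(n) floor(T/n) is 1. Replacing floor(T/n) by T/n costs less than 1 for each n from
    2 to T and nothing for n = 1, so T times the sum is at most 1 + (T - 1) in absolute value. *)
Lemma logsum0_le1 x : `|logsum 0 x| <= 1.
Proof.
rewrite /logsum; set T := Num.truncn x.
have [T0|T0] := posnP T; first by rewrite T0 big_geq// normr0.
under eq_bigr do rewrite expr0 mulr1.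
have H : \sum_(1 <= n < T.+1) moebiusR n * (T %/ n)%:R = 1.
  rewrite -[RHS](moebius_hyperbola (fun _ => 1) T0); apply: eq_bigr => n _.
  by rewrite sumr_const_nat subn1.
have TR : 0 < T%:R :> R by rewrite ltr0n.
rewrite -(ler_pM2l TR) -[X in X * `|_|](ger0_norm (ltW TR)) -normrM mulr1.
have -> : T%:R * (\sum_(1 <= n < T.+1) moebiusR n / n%:R) =
   1 + \sum_(1 <= n < T.+1) moebiusR n * (T%:R / n%:R - (T %/ n)%:R) :> R.
  rewrite -[X in _ = X + _]H -big_split /= mulr_sumr; apply: eq_bigr => n _.
  by ring.
rewrite big_ltn// divr1 divn1 subrr mulr0 add0r.
rewrite (le_trans (ler_normD _ _))// normr1.
have TE : T%:R = 1 + \sum_(2 <= n < T.+1) 1 :> R.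
  by rewrite sumr_const_nat subSS subn1 -[1 + _]mulrS prednK.
rewrite [leRHS]TE lerD2l (le_trans (ler_norm_sum _ _ _))// big_nat [leRHS]big_nat ler_sum//.
move=> n /andP[n1 nT]; have n0 : (0 < n)%N by apply: leq_trans n1.
have nR : 0 < n%:R :> R by rewrite ltr0n.
rewrite normrM -[leRHS]mulr1 ler_pM ?moebiusR_norm//.
have e : T%:R / n%:R - (T %/ n)%:R = (T %% n)%:R / n%:R :> R.
  by rewrite {1}(divn_eq T n) natrD natrM; field; rewrite gt_eqF.
by rewrite e ger0_norm ?divr_ge0// ler_pdivrMr// mul1r ler_nat ltnW// ltn_pmod.
Qed.

Lemma sum_logsum1 x : 1 <= x ->
  \sum_(1 <= m < (Num.truncn x).+1) m%:R^-1 * logsum 1 (x / m%:R) = ln x.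
Proof.
move=> x1; have x0 : 0 <= x by apply: le_trans x1.
have T0 : (0 < Num.truncn x)%N by rewrite truncn_gt0.
have := moebius_hyperbola (fun k => k%:R^-1 * ln (x / k%:R)) T0.
rewrite divr1 invr1 mul1r => <-.
under [RHS]eq_bigr do rewrite mulr_sumr.
rewrite [RHS]exchange_hyperbola big_nat [RHS]big_nat; apply: eq_bigr => m /andP[m0 _].
rewrite /logsum truncn_divn// mulr_sumr; apply: eq_bigr => n _.
by rewrite expr1 natrM !invfM !mulrA /moebiusR [x / m%:R / _]mulrAC; ring.
Qed.

Lemma moebius_inversion (G : R -> R) x : 1 <= x ->
  \sum_(1 <= n < (Num.truncn x).+1) moebiusR n / n%:R *
    \sum_(1 <= m < (Num.truncn (x / n%:R)).+1) m%:R^-1 * G (x / n%:R / m%:R) = G x.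
Proof.
move=> x1; have x0 : 0 <= x by apply: le_trans x1.
have T0 : (0 < Num.truncn x)%N by rewrite truncn_gt0.
have := moebius_hyperbola (fun k => k%:R^-1 * G (x / k%:R)) T0.
rewrite divr1 invr1 mul1r => <-.
rewrite big_nat [RHS]big_nat; apply: eq_bigr => n /andP[n0 _].
rewrite truncn_divn// -mulrA; congr (_ * _); rewrite mulr_sumr; apply: eq_bigr => m _.
by rewrite natrM !invfM !mulrA.
Qed.

End DirichletSums.

(** * The expansion of the sums of log(t/m)/m *)

Section LogBounds.
Variable R : realType.
Implicit Types (x z t : R).

Lemma is_derive_ge0_le (f df : R -> R) (a b : R) : a <= b ->
  (forall x, a <= x <= b -> is_derive x 1 f (df x)) ->
  (forall x, a <= x <= b -> 0 <= df x) -> f a <= f b.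
Proof.
move=> ab dfE df0.
have fc : {within `[a, b], continuous f}%classic.
  apply: derivable_within_continuous => x; rewrite in_itv /= => xab.
  by have [] := dfE _ xab.
have fd x : x \in `]a, b[ -> is_derive x 1 f (df x).
  by rewrite in_itv /= => /andP[/ltW ax /ltW xb]; apply: dfE; rewrite ax.
have [c] := MVT_segment ab fd fc.
rewrite in_itv /= => cab fE; rewrite -subr_ge0 fE mulr_ge0 ?df0//.
by rewrite subr_ge0.
Qed.

(** The logarithm is 2 (z + z^3/3 + z^5/5 + ...). Its first term is the lower bound; replacing 1/5,
    1/7, ... by 1/3 gives a geometric series and the upper bound. The proof compares derivatives on
    [0, z]. *)
Lemma ln_atanh_bounds z : 0 <= z < 1 ->
  2 * z <= ln ((1 + z) / (1 - z)) <= 2 * z + 2 * z ^+ 3 / (3 * (1 - z ^+ 2)).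
Proof.
move=> /andP[z0 z1].
rewrite ln_div; [|by rewrite posrE; lra|by rewrite posrE; lra].
have D (y : R) : 0 <= y <= z -> is_derive y 1 (fun y : R => ln (1 + y) - ln (1 - y)) (2 / (1 - y ^+ 2)).
  move=> /andP[y0 yz].
  have y1 : 0 < 1 + y by lra.
  have y2 : 0 < 1 - y by lra.
  have d1 := is_derive1_ln y1; have d2 := is_derive1_ln y2.
  have e1 : is_derive y 1 (fun y : R => ln (1 + y)) (1 + y)^-1.
    have := @is_derive1_comp R (@ln R) (fun y => 1 + y) y _ (0 + 1) d1 _.
    by rewrite add0r mulr1; apply; rewrite -[X in is_derive _ _ _ X]add0r; apply: (is_deriveD (f := cst (1:R)) (g := id)).
  have e2 : is_derive y 1 (fun y : R => ln (1 - y)) (- (1 - y)^-1).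
    have := @is_derive1_comp R (@ln R) (fun y => 1 - y) y _ (0 - 1) d2 _.
    by rewrite add0r mulrN1; apply; rewrite -[X in is_derive _ _ _ X]add0r; apply: (is_deriveB (f := cst (1:R)) (g := id)).
  apply: is_derive_eq; rewrite opprK.
  have -> : 1 - y ^+ 2 = (1 + y) * (1 - y) by ring.
  by field; rewrite !gt_eqF.
have y2pos y : 0 <= y <= z -> 0 < 1 - y ^+ 2.
  move=> /andP[y0 yz]; rewrite subr_gt0 expr_lt1//; lra.
apply/andP; split; rewrite -subr_ge0.
  pose g (y : R) := ln (1 + y) - ln (1 - y) - 2 * y.
  have : g 0 <= g z.
    apply: (@is_derive_ge0_le g (fun y => 2 / (1 - y ^+ 2) - 2) 0 z z0) => y yz.
      have := D _ yz => Dy; rewrite /g; apply: is_derive_eq.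
      by rewrite /GRing.scale /= mulr1.
    have y0 := y2pos _ yz.
    rewrite subr_ge0 ler_pdivlMr//; nra.
  by rewrite /g addr0 subr0 ln1 subr0 mulr0 subr0.
pose g (y : R) := 2 * y + 2 * y ^+ 3 / (3 * (1 - y ^+ 2)) - (ln (1 + y) - ln (1 - y)).
have : g 0 <= g z.
  apply: (@is_derive_ge0_le g (fun y => 4 / 3 * y ^+ 4 / (1 - y ^+ 2) ^+ 2) 0 z z0) => y yz.
    have Dy := D _ yz; have y0 := y2pos _ yz; rewrite /g.
    have n0 : 3 * (1 - y ^+ 2) != 0 by rewrite gt_eqF// mulr_gt0.
    apply: is_derive_eq.
    rewrite /GRing.scale /=.
    field; rewrite gt_eqF//.
  rewrite mulr_ge0// ?invr_ge0 ?exprn_even_ge0//.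
  by rewrite mulr_ge0// exprn_even_ge0.
by rewrite /g addr0 subr0 ln1 subr0 mulr0 expr0n /= mulr0 mul0r addr0 subr0.
Qed.

(** This is [ln_atanh_bounds] at z = 1/(2x + 1). *)
Lemma ln_ratio_bounds x : 0 < x ->
  2 / (2 * x + 1) <= ln ((x + 1) / x)
     <= 2 / (2 * x + 1) + (6 * x * (x + 1) * (2 * x + 1))^-1.
Proof.
move=> x0.
have h : 0 <= (2 * x + 1)^-1 < 1.
  by rewrite invr_ge0 addr_ge0 ?mulr_ge0 ?ltW//= invf_lt1; lra.
have := ln_atanh_bounds h.
have -> : (1 + (2 * x + 1)^-1) / (1 - (2 * x + 1)^-1) = (x + 1) / x.
  by field; rewrite !gt_eqF//; lra.
suff -> : 2 * (2 * x + 1)^-1 ^+ 3 / (3 * (1 - (2 * x + 1)^-1 ^+ 2)) =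
   (6 * x * (x + 1) * (2 * x + 1))^-1 by [].
field; rewrite !gt_eqF//; try lra.
by have := mulr_gt0 x0 x0; lra.
Qed.

(** The supremum of the lower ends will define the constants [g] and [c] of the expansion, with
    explicit error bounds in place of limits. *)
Lemma nested_point (l u : nat -> R) : (forall n m, l n <= u m) ->
  exists g, forall n, l n <= g <= u n.
Proof.
move=> lu; exists (sup [set l n | n in setT]%classic) => n.
have hs : has_sup [set l n | n in setT]%classic.
  split; first by exists (l 0%N), 0%N.
  by exists (u 0%N) => _ [m _ <-].
apply/andP; split; first by apply: sup_upper_bound => //; exists n.
by apply: ge_sup; [exists (l 0%N), 0%N|move=> _ [m _ <-]].
Qed.

Lemma nested_monotone_point (l u : nat -> R) :
  (forall n, l n <= l n.+1) -> (forall n, u n.+1 <= u n) -> (forall n, l n <= u n) ->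
  exists g, forall n, l n <= g <= u n.
Proof.
move=> li ud lu; apply: nested_point => n m.
have hl : {homo l : a b / (a <= b)%N >-> a <= b} by apply: homo_leq => // ? ? ?; exact: le_trans.
have hu : {homo u : a b / (a <= b)%N >-> b <= a}.
  apply: (homo_leq (r := fun a b => b <= a)) => // ? ? ? h1 h2; exact: le_trans h2 h1.
apply: (le_trans (hl _ _ (leq_maxl n m))).
by apply: (le_trans (lu _)); apply: hu; exact: leq_maxr.
Qed.

Definition harm n : R := \sum_(1 <= m < n.+1) m%:R^-1.
Definition harmln n : R := \sum_(1 <= m < n.+1) ln m%:R / m%:R.

Lemma harmS n : harm n.+1 = harm n + n.+1%:R^-1.
Proof. by rewrite /harm big_nat_recr. Qed.

Lemma harmlnS n : harmln n.+1 = harmln n + ln n.+1%:R / n.+1%:R.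
Proof. by rewrite /harmln big_nat_recr. Qed.

Lemma lnS_bounds n : (0 < n)%N ->
  2 / (2 * n%:R + 1) <= (ln n.+1%:R - ln n%:R : R)
     <= 2 / (2 * n%:R + 1) + (6 * n%:R * (n%:R + 1) * (2 * n%:R + 1))^-1.
Proof.
move=> n0; have nR : 0 < n%:R :> R by rewrite ltr0n.
by have := ln_ratio_bounds nR; rewrite natr1 ln_div ?posrE ?ltr0n// natr1.
Qed.

(** An upper approximation to Euler's constant. Averaging the two logarithms reduces the error from
    order 1/n to order 1/n^2. *)
Definition gamma_up n : R := harm n - (ln n%:R + ln n.+1%:R) / 2.

(** From n + 1 to n + 2, [gamma_up] changes by 1/(n + 2) - log((n + 3)/(n + 1))/2, to which
    [ln_atanh_bounds] at z = 1/(n + 2) applies. The lower bound makes [gamma_up] decrease; half the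
    cubic term of the upper bound is exactly the difference of consecutive error terms 1/(6 n (n +
    1)). *)
Lemma gamma_exists : exists g : R, forall n, (0 < n)%N ->
  gamma_up n - (6 * n%:R * (n%:R + 1))^-1 <= g <= gamma_up n.
Proof.
have [|||g hg] := @nested_monotone_point (fun n => gamma_up n.+1 - (6 * n.+1%:R * (n.+1%:R + 1))^-1)
   (fun n => gamma_up n.+1).
- move=> n; rewrite /gamma_up !harmS.
  have n1 : 0 < n.+1%:R :> R by rewrite ltr0n.
  have h : 0 <= (n.+2%:R^-1 : R) < 1 by rewrite invr_ge0 ler0n invf_lt1 ?ltr1n ?ltr0n.
  have /andP[_] := ln_atanh_bounds h.
  have -> : (1 + n.+2%:R^-1) / (1 - n.+2%:R^-1) = n.+3%:R / n.+1%:R :> R.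
    rewrite -[n.+3%:R]natr1 -[n.+2%:R]natr1; field.
    by rewrite -?natr1; have := ler0n R n => ?; rewrite !gt_eqF//; lra.
  rewrite ln_div ?posrE ?ltr0n// -[n.+2%:R]natr1.
  move: (n.+1%:R : R) n1 (ln _ : R) (ln _ : R) (ln _ : R) => x x0 a b c H.
  have E : 2 * (x + 1)^-1 + 2 * (x + 1)^-1 ^+ 3 / (3 * (1 - (x + 1)^-1 ^+ 2)) =
     2 * (x + 1)^-1 + 2 * ((6 * x * (x + 1))^-1 - (6 * (x + 1) * (x + 1 + 1))^-1).
    field; rewrite !gt_eqF//; try lra.
    by have := mulr_gt0 x0 x0; lra.
  rewrite E in H; lra.
- move=> n; rewrite /gamma_up !harmS.
  have n1 : 0 < n.+1%:R :> R by rewrite ltr0n.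
  have h : 0 <= (n.+2%:R^-1 : R) < 1 by rewrite invr_ge0 ler0n invf_lt1 ?ltr1n ?ltr0n.
  have /andP[+ _] := ln_atanh_bounds h.
  have -> : (1 + n.+2%:R^-1) / (1 - n.+2%:R^-1) = n.+3%:R / n.+1%:R :> R.
    rewrite -[n.+3%:R]natr1 -[n.+2%:R]natr1; field.
    by rewrite -?natr1; have := ler0n R n => ?; rewrite !gt_eqF//; lra.
  rewrite ln_div ?posrE ?ltr0n//.
  by move: (n.+2%:R^-1 : R) (n.+1%:R^-1 : R) (ln n.+1%:R : R) (ln n.+2%:R : R) (ln n.+3%:R : R) (harm n) => u v a b c d H; lra.
- move=> n; rewrite lerBlDr lerDl invr_ge0 !mulr_ge0// addr_ge0//.
by exists g => -[//|n] _; exact: hg.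
Qed.

Definition hlog_sum t : R := \sum_(1 <= m < (Num.truncn t).+1) m%:R^-1 * ln (t / m%:R).

Lemma hlog_sumE t : 1 <= t -> hlog_sum t = harm (Num.truncn t) * ln t - harmln (Num.truncn t).
Proof.
move=> t1; rewrite /hlog_sum /harm /harmln mulr_suml -sumrB big_nat [RHS]big_nat.
apply: eq_bigr => m /andP[m0 _]; rewrite ln_div ?posrE ?ltr0n//; last by lra.
by rewrite mulrBr [ln m%:R / _]mulrC.
Qed.

(** Here [g] is Euler's constant and [c] is minus the first Stieltjes constant. The order 1/t^2 of
    the error keeps the sum of the errors at t = x/n, weighted by 1/n, bounded. *)
Lemma harmonic_log_expansion : exists g c : R,
  [/\ forall n, (0 < n)%N -> gamma_up n - (6 * n%:R * (n%:R + 1))^-1 <= g <= gamma_up n,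
      0 <= c <= 1 / 12 &
      forall t, 1 <= t -> - (12 * (Num.truncn t)%:R ^+ 2)^-1
         <= hlog_sum t - (ln t ^+ 2 / 2 + g * ln t + c) <= (8 * (Num.truncn t)%:R ^+ 2)^-1].
Proof.
have [g hg] := gamma_exists.
(* The value of the remainder at t = n is D n - c. Between two consecutive integers the
   remainder is a concave quadratic in ln t, which [key] writes as the chord plus a
   product of distances to the end points. *)
pose D n := harm n * ln n%:R - harmln n - ln n%:R ^+ 2 / 2 - g * ln n%:R.
have stepD n : (0 < n)%N -> D n.+1 - D n =
    (ln n.+1%:R - ln n%:R) * (gamma_up n - g).
  by move=> n0; rewrite /D harmS harmlnS /gamma_up; field; rewrite gt_eqF// addr_gt0.
have dlt n : (0 < n)%N -> 0 < ln n.+1%:R - ln n%:R :> R.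
  by move=> n0; rewrite subr_gt0 ltr_ln ?posrE ?ltr0n// ltr_nat.
have dup n : (0 < n)%N -> ln n.+1%:R - ln n%:R <= (2 * n%:R + 1) / (2 * n%:R * (n%:R + 1)) :> R.
  move=> n0; have nR : 0 < n%:R :> R by rewrite ltr0n.
  have /andP[_ H] := lnS_bounds n0; apply: (le_trans H); rewrite -subr_ge0.
  have -> : (2 * n%:R + 1) / (2 * n%:R * (n%:R + 1)) -
     (2 / (2 * n%:R + 1) + (6 * n%:R * (n%:R + 1) * (2 * n%:R + 1))^-1) =
     2 / (6 * n%:R * (n%:R + 1) * (2 * n%:R + 1)) :> R.
    by field; rewrite !gt_eqF//; lra.
  by rewrite divr_ge0// !mulr_ge0//; lra.
have [|||c hc] := @nested_monotone_point (fun n => D n.+1) (fun n => D n.+1 + (12 * n.+1%:R ^+ 2)^-1).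
- move=> n; rewrite -subr_ge0 stepD// mulr_ge0 ?(ltW (dlt _ _))//.
  by have /andP[_] := hg n.+1 isT; rewrite subr_ge0.
- move=> n; rewrite -subr_ge0.
  have /andP[H _] := hg n.+1 isT.
  have d0 := dlt n.+1 isT; have d1 := dup n.+1 isT.
  have nR : 0 < n.+1%:R :> R by rewrite ltr0n.
  have : D n.+2 - D n.+1 <= (2 * n.+1%:R + 1) / (2 * n.+1%:R * (n.+1%:R + 1)) * (6 * n.+1%:R * (n.+1%:R + 1))^-1.
    rewrite stepD//; apply: ler_pM => //; first exact: ltW.
      by rewrite subr_ge0; case/andP: (hg n.+1 isT).
    by rewrite lerBlDr -lerBlDl.
  rewrite -[n.+2%:R]natr1.
  (* The product of the bounds for the logarithm and for [gamma_up n - g] telescopes; this is the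
     origin of 1/(12 n^2). *)
  have -> : (2 * n.+1%:R + 1) / (2 * n.+1%:R * (n.+1%:R + 1)) * (6 * n.+1%:R * (n.+1%:R + 1))^-1
     = (12 * n.+1%:R ^+ 2)^-1 - (12 * (n.+1%:R + 1) ^+ 2)^-1 :> R.
    by field; rewrite !gt_eqF//; lra.
  move: (12 * n.+1%:R ^+ 2)^-1 (12 * (n.+1%:R + 1) ^+ 2)^-1 => e f K.
  by move: (D n.+2) (D n.+1) K => A B; lra.
- by move=> n; rewrite lerDl invr_ge0 mulr_ge0// exprn_ge0.
exists g, c; split => //.
  (* Since D vanishes at n = 1, the bounds there put c in [0, 1/12]. *)
  have := hc 0%N; rewrite /D /harm /harmln !big_nat1 ln1.
  lra.
move=> t t1; rewrite hlog_sumE//.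
have t0 : 0 < t by lra.
set T := Num.truncn t.
have T0 : (0 < T)%N by rewrite truncn_gt0.
have TR : 0 < T%:R :> R by rewrite ltr0n.
have /andP[Tt tT] : T%:R <= t < T.+1%:R by apply: truncn_itv; exact: ltW.
have at_ : ln T%:R <= ln t by rewrite ler_ln ?posrE.
have tb : ln t <= ln T.+1%:R by rewrite ler_ln ?posrE ?ltr0n// ltW.
have ab := dlt _ T0.
have /andP[qa1 qa2] : D T <= c <= D T + (12 * T%:R ^+ 2)^-1 by case: (T) T0 => // n _; exact: hc.
have /andP[qb1 qb2] := hc T.
have qb3 : D T.+1 + (12 * T.+1%:R ^+ 2)^-1 <= D T.+1 + (12 * T%:R ^+ 2)^-1.
  rewrite lerD2l lef_pV2 ?posrE ?mulr_gt0 ?exprn_gt0 ?ltr0n//.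
  by rewrite ler_pM2l// lerXn2r ?nnegrE ?ler0n// ler_nat.
have bT : ln T.+1%:R - ln T%:R <= T%:R^-1 :> R.
  apply: (le_trans (dup _ T0)); rewrite -subr_ge0.
  have -> : T%:R^-1 - (2 * T%:R + 1) / (2 * T%:R * (T%:R + 1)) = (2 * T%:R * (T%:R + 1))^-1 :> R.
    by field; rewrite !gt_eqF//; lra.
  by rewrite invr_ge0 !mulr_ge0//; lra.
pose q := harm T * ln t - harmln T - (ln t ^+ 2 / 2 + g * ln t + c).
have key : (ln T.+1%:R - ln T%:R) * q = (ln T.+1%:R - ln t) * (D T - c) + (ln t - ln T%:R) * (D T.+1 - c)
    + (ln T.+1%:R - ln T%:R) * ((ln t - ln T%:R) * (ln T.+1%:R - ln t) / 2).
  rewrite /q /D harmS harmlnS.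
  by field; rewrite gt_eqF// addr_gt0.
rewrite -/q; move: (D T) (D T.+1) (12 * T%:R ^+ 2)^-1 (12 * T.+1%:R ^+ 2)^-1 (ln T%:R : R) (ln T.+1%:R : R) (ln t) q key at_ tb ab qa1 qa2 qb1 qb2 qb3 bT => A B e e' a b u q key au ub ab A1 A2 B1 B2 B3 bT.
apply/andP; split.
  rewrite -(ler_pM2l ab) key.
  have h1 : (b - u) * (A - c) >= (b - u) * (- e) by rewrite ler_wpM2l//; lra.
  have h2 : (u - a) * (B - c) >= (u - a) * (- e) by rewrite ler_wpM2l//; lra.
  have h3 : 0 <= (b - a) * ((u - a) * (b - u) / 2).
    by rewrite !mulr_ge0//; lra.
  lra.
rewrite -(ler_pM2l ab) key.
have h1 : (b - u) * (A - c) <= 0 by rewrite mulr_ge0_le0//; lra.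
have h2 : (u - a) * (B - c) <= 0 by rewrite mulr_ge0_le0//; lra.
(* The product of the two distances is at most (b - a)^2 / 4, and b - a <= 1/T; hence the 8. *)
suff h3 : (b - a) * ((u - a) * (b - u) / 2) <= (b - a) * (8 * T%:R ^+ 2)^-1 by lra.
rewrite ler_pM2l//.
have -> : (8 * T%:R ^+ 2)^-1 = T%:R^-1 ^+ 2 / 8 :> R by field; rewrite gt_eqF.
have : (b - a) ^+ 2 <= T%:R^-1 ^+ 2 by rewrite lerXn2r ?nnegrE ?invr_ge0//; lra.
have : 0 <= (u - a - (b - u)) ^+ 2 by exact: sqr_ge0.
lra.
Qed.

End LogBounds.

(** * Fixed-point tables of the Möbius sums *)

(* The delimiter Z belongs to MathComp's int_scope. *)
Delimit Scope Z_scope with coqZ.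
Arguments Z.add : simpl never.
Arguments Z.mul : simpl never.
Arguments Z.opp : simpl never.
Arguments Z.div : simpl never.
Arguments Z.modulo : simpl never.
Arguments Z.of_nat : simpl never.
Arguments Z.to_nat : simpl never.

(** Trial division by increasing primes, with [s] carrying the sign of those already divided out. A
    cofactor below [p * p] without smaller prime factors is 1 or a prime; the empty list is treated
    alike, which is right below 97^2 for the list used here. *)
Fixpoint moebius_trial (ps : seq Z) (s n : Z) : Z :=
  match ps with
  | nil => if Z.eqb n 1 then s else Z.opp s
  | p :: ps' =>
      if Z.ltb n (p * p)%coqZ then (if Z.eqb n 1 then s else Z.opp s)
      else let (c, r) := Z.div_eucl n p in
           if Z.eqb r 0 then
             (if Z.eqb (Z.modulo c p) 0 then 0%coqZ else moebius_trial ps' (Z.opp s) c)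
           else moebius_trial ps' s n
  end.

Definition primes_lt97 : seq nat :=
  [:: 2; 3; 5; 7; 11; 13; 17; 19; 23; 29; 31; 37; 41; 43; 47; 53; 59; 61; 67;
      71; 73; 79; 83; 89]%N.

Definition zprimes_lt97 : seq Z :=
  [:: 2; 3; 5; 7; 11; 13; 17; 19; 23; 29; 31; 37; 41; 43; 47; 53; 59; 61; 67;
      71; 73; 79; 83; 89]%coqZ.

Lemma moebius_prime p : prime p -> moebius p = -1.
Proof. by move=> pp; rewrite -[X in moebius X]muln1 moebius_pmul ?coprimen1// moebius1. Qed.

Lemma Z_of_nat_div (n p : nat) : (0 < p)%N ->
  Z.of_nat (n %/ p) = Z.div (Z.of_nat n) (Z.of_nat p) /\
  Z.of_nat (n %% p) = Z.modulo (Z.of_nat n) (Z.of_nat p).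
Proof.
move=> p0; have := divn_eq n p; have := ltn_pmod n p0.
move: (n %/ p)%N (n %% p)%N => q r hr hn; split.
  by apply: (Z.div_unique _ _ _ (Z.of_nat r)); [left|]; lia.
by apply: (Z.mod_unique _ _ (Z.of_nat q)); [left|]; lia.
Qed.

Lemma div_eucl_of_nat (n p : nat) : (0 < p)%N ->
  Z.div_eucl (Z.of_nat n) (Z.of_nat p) = (Z.of_nat (n %/ p), Z.of_nat (n %% p)).
Proof.
move=> p0; have [-> ->] := Z_of_nat_div n p0.
by rewrite /Z.div /Z.modulo; case: Z.div_eucl.
Qed.

Lemma moebius_trialE (ps : seq nat) (s : Z) (n : nat) :
  (0 < n < 97 * 97)%N -> all prime ps -> all (fun p => p < 97)%N ps -> sorted ltn ps ->
  (forall q, prime q -> (q %| n)%N -> (q \in ps) || (97 <= q)%N) ->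
  moebius_trial (map Z.of_nat ps) s (Z.of_nat n) = (s * Z_of_int (moebius n))%coqZ.
Proof.
(* This serves both exits of the trial division: a cofactor below b^2 with all prime factors at
   least b is 1 or a prime. Here b is the next trial prime, or 97 once the list is exhausted. *)
have small m b s' : (0 < m)%N -> (m < b * b)%N ->
    (forall q, prime q -> (q %| m)%N -> (b <= q)%N) ->
    (if Z.eqb (Z.of_nat m) 1 then s' else Z.opp s') = (s' * Z_of_int (moebius m))%coqZ.
  move=> m0 mb hq; have [->|m1] := eqVneq m 1%N; first by rewrite moebius1 /=; lia.
  have -> : Z.eqb (Z.of_nat m) 1 = false by apply/Z.eqb_neq; lia.
  suff mp : prime m by rewrite (moebius_prime mp) /=; lia.
  apply: ltn_pdiv2_prime => //; apply: (leq_trans mb).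
  have m2 : (1 < m)%N by case: (m) m0 m1 => [|[]].
  have bp : (b <= pdiv m)%N by apply: hq; rewrite ?pdiv_prime ?pdiv_dvd.
  by rewrite -mulnn leq_mul.
elim: ps s n => [|p ps IH] s n /andP[n0 n97] /=.
  by move=> _ _ _ hq; apply: (small _ 97%N) => // q pq qn; have := hq q pq qn.
move=> /andP[pp aps] /andP[p97 a97] so hq.
have p0 := prime_gt0 pp.
have sops : sorted ltn ps by apply: path_sorted so.
have ltp q : q \in ps -> (p < q)%N.
  by move=> qps; have /allP := order_path_min ltn_trans so; apply.
case: Z.ltb_spec => hnp.
  apply: (small _ p) => //; first by lia.
  move=> q pq qn; have := hq q pq qn; rewrite in_cons -orbA => /or3P[/eqP->//|/ltp/ltnW//|].
  exact/leq_trans/ltnW.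
rewrite div_eucl_of_nat//.
case: Z.eqb_spec => hr.
  have pn : (p %| n)%N by rewrite /dvdn; apply/eqP; lia.
  have c0 : (0 < n %/ p)%N by rewrite divn_gt0// dvdn_leq.
  have ncp : n = (p * (n %/ p))%N by rewrite mulnC divnK.
  rewrite -(Z_of_nat_div _ p0).2; case: Z.eqb_spec => hc.
    have pc : (p %| n %/ p)%N by rewrite /dvdn; apply/eqP; lia.
    by rewrite ncp (moebius_psqr pp c0 pc) /=; lia.
  have pc : ~~ (p %| n %/ p)%N by rewrite /dvdn; apply/eqP; lia.
  rewrite IH//.
  - by rewrite [in RHS]ncp moebius_pmul ?prime_coprime// rmorphN /=; lia.
  - by rewrite c0 (leq_ltn_trans _ n97)// leq_div.
  move=> q pq qc; have /orP[|->] := hq q pq (dvdn_trans qc (dvdn_div pn)); last by rewrite orbT.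
  by rewrite in_cons => /orP[/eqP qp|-> //]; move: pc; rewrite -{1}qp qc.
have pn : ~~ (p %| n)%N by rewrite /dvdn; apply/eqP; lia.
apply: IH => //; first by rewrite n0.
move=> q pq qn; have /orP[|->] := hq q pq qn; last by rewrite orbT.
by rewrite in_cons => /orP[/eqP qp|-> //]; move: pn; rewrite -{1}qp qn.
Qed.

Lemma moebius_trial97 (n : nat) : (0 < n < 97 * 97)%N ->
  moebius_trial zprimes_lt97 1 (Z.of_nat n) = Z_of_int (moebius n).
Proof.
move=> n97; have -> : zprimes_lt97 = map Z.of_nat primes_lt97 by [].
rewrite moebius_trialE// ?Z.mul_1_l// => q pq _.
case: (leqP 97 q) => [|q97]; first by rewrite orbT.
have /allP : all (fun q => prime q ==> (q \in primes_lt97)) (iota 0 97) by vm_compute.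
by move=> /(_ q); rewrite mem_iota q97 pq /= => ->.
Qed.

(* 2 ^ 34 *)
Definition scale : Z := 17179869184%coqZ.

Fixpoint log_incr (j : nat) (k : Z) : Z :=
  match j with
  | O => 0%coqZ
  | S j' => (2 * scale / (2 * k + 1) + log_incr j' (k + 1))%coqZ
  end.

(* At the integer n = tn: ta ~ scale * sum_{j <= n} mu(j)/j, with error at most n, and
   tw ~ scale^2 * L(n), with error at most tr; see [table_inv]. *)
Record state := State { tn : Z; ta : Z; tw : Z; tr : Z }.

(* log((n+1)/n) is the sum of log((k+1)/k) over the A integers k from A n on, where
   A = pieces n makes k >= 257, so that 2/(2k+1) approximates each term to 85/scale;
   rounding costs one more unit. *)
Definition pieces (n : Z) : Z := (256 / n + 1)%coqZ.
Definition log_step (n : Z) : Z := log_incr (Z.to_nat (pieces n)) (pieces n * n).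
Definition log_slack (n : Z) : Z := (86 * pieces n)%coqZ.

(** The recurrences [logsumN0S] and [logsumN1S] in fixed point. The increment of [tr] is the bound
    of [mul_err], with n as the error of [ta] and g as that of the logarithm. *)
Definition step (t : state) : state :=
  let (n, a, w, r) := t in
  let d := log_step n in
  let g := log_slack n in
  let n' := (n + 1)%coqZ in
  State n' (a + moebius_trial zprimes_lt97 1 n' * (scale / n'))
    (w + a * d) (r + n * (d + g) + Z.abs a * g).

(** The test follows each step, so the initial state is not tested. *)
Fixpoint run (chk : state -> bool) (k : nat) (t : state) : state * bool :=
  match k with
  | O => (t, true)
  | S k' => let t' := step t in if chk t' then run chk k' t' else (t', false)
  end.

Section Table.
Variable R : realType.

(* Locked, so that unification never evaluates large integers in unary. *)
Definition zr (z : Z) : R := locked (fun z => (int_of_Z z)%:~R) z.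

Lemma zr_intr z : zr z = (int_of_Z z)%:~R.
Proof. by rewrite /zr -lock. Qed.

Lemma zrD a b : zr (a + b) = zr a + zr b.
Proof. by rewrite !zr_intr -intrD; congr (_%:~R); lia. Qed.
Lemma zrM a b : zr (a * b) = zr a * zr b.
Proof. by rewrite !zr_intr -intrM; congr (_%:~R); lia. Qed.
Lemma zrN a : zr (- a) = - zr a.
Proof. by rewrite !zr_intr -mulrNz; congr (_ *~ _); lia. Qed.
Lemma zrB a b : zr (a - b) = zr a - zr b.
Proof. by rewrite !zr_intr -intrB; congr (_%:~R); lia. Qed.
Lemma zr_nat n : zr (Z.of_nat n) = n%:R.
Proof. by rewrite !zr_intr -[RHS]/(n%:~R); congr (_%:~R); lia. Qed.
Lemma zr_int n : zr (Z_of_int n) = n%:~R.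
Proof. by rewrite !zr_intr; congr (_%:~R); lia. Qed.
Lemma zr_le a b : (zr a <= zr b) = (a <=? b)%coqZ.
Proof. by rewrite !zr_intr ler_int; lia. Qed.
Lemma zr_abs a : zr (Z.abs a) = `|zr a|.
Proof. by rewrite !zr_intr -intr_norm; congr (_%:~R); lia. Qed.
Lemma zr0 : zr 0 = 0. Proof. by rewrite zr_intr. Qed.
Lemma zr1 : zr 1 = 1. Proof. by rewrite zr_intr. Qed.
Lemma zr2 : zr 2 = 2. Proof. by rewrite zr_intr. Qed.
Lemma zr_xO p : zr (Zpos p~0) = 2 * zr (Zpos p).
Proof. by rewrite -[Zpos p~0]/(2 * Zpos p)%coqZ zrM zr2. Qed.
Lemma zr_xI p : zr (Zpos p~1) = 2 * zr (Zpos p) + 1.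
Proof. by rewrite -[Zpos p~1]/(2 * Zpos p + 1)%coqZ zrD zrM zr2 zr1. Qed.
Lemma zr_neg p : zr (Zneg p) = - zr (Zpos p).
Proof. by rewrite -[Zneg p]/(- Zpos p)%coqZ zrN. Qed.

Definition zrE := (zr_xO, zr_xI, zr_neg, zr0, zr1).

Lemma zr_scale_gt0 : 0 < zr scale.
Proof. by rewrite lt_def -zr0 zr_le andbT !zr_intr eqr_int. Qed.

Lemma zr_div a b : (0 < b)%coqZ -> zr (a / b) <= zr a / zr b <= zr (a / b) + 1.
Proof.
move=> b0; have bR : 0 < zr b by rewrite lt_neqAle -zr0 zr_le; apply/andP; split; [|lia]; rewrite !zr_intr eqr_int; lia.
rewrite ler_pdivlMr// ler_pdivrMr// -zr1 -zrD -!zrM !zr_le.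
have := Z.div_mod a b ltac:(lia); have := Z.mod_pos_bound a b b0.
by move: (a / b)%coqZ (a mod b)%coqZ => q r *; apply/andP; split; apply/Z.leb_le; lia.
Qed.

Lemma log_incr_bound (k : nat) j : (257 <= k)%N ->
  0 <= zr scale * (ln (k + j)%:R - ln k%:R) - zr (log_incr j (Z.of_nat k)) <= 86 * j%:R.
Proof.
elim: j k => [|j IH] k k257 /=; first by rewrite addn0 !subrr mulr0 zr0 subr0 mulr0 lexx.
have -> : (Z.of_nat k + 1)%coqZ = Z.of_nat k.+1 by lia.
have := IH k.+1 (leqW k257); rewrite addSnnS zrD -[j.+1%:R]natr1 => /andP[h1 h2].
have k0 : (0 < k)%N by apply: leq_trans k257.
have /andP[h3 h4] := lnS_bounds R k0.
have kR : 257 <= k%:R :> R by rewrite (ler_nat _ 257).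
have := @zr_div (2 * scale)%coqZ (2 * Z.of_nat k + 1)%coqZ ltac:(lia).
rewrite !zrD !zrM zr_nat zr1 zr2.
move=> /andP[h5 h6].
have s0 := zr_scale_gt0.
have e : zr scale * (6 * k%:R * (k%:R + 1) * (2 * k%:R + 1))^-1 <= 85.
  rewrite ler_pdivrMr; last by rewrite !mulr_gt0//; lra.
  have : zr scale <= zr (85 * (6 * Z.of_nat k * (Z.of_nat k + 1) * (2 * Z.of_nat k + 1))).
    rewrite zr_le; apply/Z.leb_le.
    have : (257 <= Z.of_nat k)%coqZ by lia.
    move: (Z.of_nat k) => z z257.
    have q1 : (257 * 258 <= z * (z + 1))%coqZ by nia.
    have q2 : (257 * 258 * 515 <= z * (z + 1) * (2 * z + 1))%coqZ by nia.
    by rewrite /scale; lia.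
  have e6 : zr 6 = 6 by rewrite zr_intr.
  have e85 : zr 85 = 85 by rewrite zr_intr.
  move: (zr scale) => s.
  by rewrite (zrM 85) (zrM (6 * _ * _)) (zrM (6 * _)) (zrM 6) !zrD (zrM 2) zr_nat zr1 zr2 e6 e85.
have h3' : 2 * zr scale / (2 * k%:R + 1) <= zr scale * (ln k.+1%:R - ln k%:R).
  by rewrite [2 * _]mulrC -mulrA ler_pM2l.
have h4' : zr scale * (ln k.+1%:R - ln k%:R) <= 2 * zr scale / (2 * k%:R + 1) + 85.
  apply: (@le_trans _ _ (zr scale * (2 / (2 * k%:R + 1) + (6 * k%:R * (k%:R + 1) * (2 * k%:R + 1))^-1))).
    by rewrite ler_pM2l.
  by rewrite mulrDr mulrA [zr scale * 2]mulrC lerD2l.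
move: h1 h2 h3' h4' h5 h6.
move: (2 * zr scale / (2 * k%:R + 1)) (zr (2 * scale / _)) (zr (log_incr _ _)) => x y z.
move: (ln k.+1%:R : R) (ln k%:R : R) (ln (k + j.+1)%:R : R) => a b c.
rewrite !mulrBr; move: (zr scale * a) (zr scale * b) (zr scale * c) => A B C *.
by apply/andP; split; lra.
Qed.

Lemma log_step_bound (n : nat) : (0 < n)%N ->
  0 <= zr scale * (ln n.+1%:R - ln n%:R) - zr (log_step (Z.of_nat n)) <= zr (log_slack (Z.of_nat n)).
Proof.
move=> n0; pose A := (256 %/ n).+1.
have AE : pieces (Z.of_nat n) = Z.of_nat A.
  by rewrite /pieces -[256%coqZ]/(Z.of_nat 256) -(Z_of_nat_div _ n0).1 /A; lia.
have An : (257 <= A * n)%N by rewrite /A; have := ltn_ceil 256 n0; lia.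
have := log_incr_bound A An.
rewrite /log_step /log_slack AE -Nat2Z.inj_mul Nat2Z.id zrM zr_nat.
rewrite (_ : (A * n)%coq_nat = (A * n)%N)//.
have -> : zr 86 = 86 by rewrite !zrE; lra.
have -> : ln (A * n + A)%:R - ln (A * n)%:R = ln n.+1%:R - ln n%:R :> R.
  rewrite -mulnSr !natrM !lnM ?posrE ?ltr0n//; ring.
by [].
Qed.

(** The values of [logsum] at integers, with log(n/j) split so that passing from n to n + 1 shifts
    every logarithm by the same amount. *)
Definition logsumN k n : R := \sum_(1 <= j < n.+1) moebiusR R j / j%:R * (ln n%:R - ln j%:R) ^+ k.

Lemma logsumN0S n : logsumN 0 n.+1 = logsumN 0 n + moebiusR R n.+1 / n.+1%:R.
Proof. by rewrite /logsumN big_nat_recr//= expr0 mulr1. Qed.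

Lemma logsumN1S n : logsumN 1 n.+1 = logsumN 1 n + logsumN 0 n * (ln n.+1%:R - ln n%:R).
Proof.
rewrite /logsumN big_nat_recr//= subrr mulr0 addr0 mulr_suml -big_split /=.
by apply: eq_bigr => j _; rewrite expr0 !expr1; ring.
Qed.

(** Each squared logarithm grows by the common increment times the sum of its old and new values. *)
Lemma logsumN2S n : logsumN 2 n.+1 = logsumN 2 n + (ln n.+1%:R - ln n%:R) * (logsumN 1 n + logsumN 1 n.+1).
Proof.
rewrite logsumN1S /logsumN big_nat_recr//= subrr expr0n mulr0 addr0.
rewrite mulrDr mulrDr mulr_suml !mulr_sumr -!big_split /=.
by apply: eq_bigr => j _; rewrite expr0 !expr1; ring.
Qed.

(** Between consecutive integers L is affine in log x, so its values at integers control it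
    everywhere. *)
Lemma logsum1_trunc (x : R) : 1 <= x ->
  logsum 1 x = logsumN 1 (Num.truncn x) + logsumN 0 (Num.truncn x) * (ln x - ln (Num.truncn x)%:R).
Proof.
move=> x1; rewrite /logsum /logsumN mulr_suml -big_split /= big_nat [RHS]big_nat.
apply: eq_bigr => j /andP[j0 _]; rewrite ln_div ?posrE ?ltr0n ?(lt_le_trans ltr01)//.
by rewrite expr0 !expr1; ring.
Qed.

Definition table_inv (n : nat) (t : state) := [/\ tn t = Z.of_nat n,
  `|zr scale * logsumN 0 n - zr (ta t)| <= n%:R &
  `|zr scale ^+ 2 * logsumN 1 n - zr (tw t)| <= zr (tr t)].

Lemma mul_err (x y a d e g : R) : `|x - a| <= e -> 0 <= y - d <= g -> 0 <= d ->
  `|x * y - a * d| <= e * (d + g) + `|a| * g.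
Proof.
move=> h1 /andP[h2 h3] d0.
have -> : x * y - a * d = (x - a) * y + a * (y - d) by ring.
apply: (le_trans (ler_normD _ _)); rewrite !normrM.
apply: lerD; last by rewrite ler_wpM2l// ger0_norm.
by apply: ler_pM => //; rewrite ger0_norm; lra.
Qed.

Lemma log_step_ge0 n : (0 < n)%coqZ -> (0 <= log_step n)%coqZ.
Proof.
move=> n0; rewrite /log_step.
have : (0 < pieces n * n)%coqZ by rewrite /pieces; have := Z.div_pos 256 n; nia.
move: (pieces n * n)%coqZ (Z.to_nat _) => k j; elim: j k => //= j IH k k0.
have := IH (k + 1)%coqZ ltac:(lia); have := Z.div_pos (2 * scale) (2 * k + 1) ltac:(done) ltac:(lia); lia.
Qed.

Lemma table_inv_intro n a w r : `|zr scale * logsumN 0 n - zr a| <= n%:R ->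
  `|zr scale ^+ 2 * logsumN 1 n - zr w| <= zr r -> table_inv n (State (Z.of_nat n) a w r).
Proof. by split. Qed.

Lemma step_inv n t : (0 < n < 97 * 97 - 1)%N -> table_inv n t -> table_inv n.+1 (step t).
Proof.
move=> /andP[n0 n97]; case: t => n' a w r [].
rewrite [tn _]/= [ta _]/= [tw _]/= [tr _]/= => -> ha hw.
have nE : (Z.of_nat n + 1)%coqZ = Z.of_nat n.+1 by lia.
have -> : step (State (Z.of_nat n) a w r) = State (Z.of_nat n.+1)
    (a + moebius_trial zprimes_lt97 1 (Z.of_nat n.+1) * (scale / Z.of_nat n.+1))
    (w + a * log_step (Z.of_nat n))
    (r + Z.of_nat n * (log_step (Z.of_nat n) + log_slack (Z.of_nat n)) + Z.abs a * log_slack (Z.of_nat n)).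
  by rewrite -nE.
apply: table_inv_intro.
  rewrite moebius_trial97; last by lia.
  rewrite logsumN0S (zrD a) (zrM (Z_of_int _)) zr_int mulrDr mulrCA.
  have := @zr_div scale (Z.of_nat n.+1) ltac:(lia); rewrite zr_nat => /andP[q1 q2].
  move: (zr (_ / _)) (zr scale / n.+1%:R) q1 q2 => q y q1 q2.
  have -> : zr scale * logsumN 0 n + moebiusR R n.+1 * y -
     (zr a + (moebius n.+1)%:~R * q) = (zr scale * logsumN 0 n - zr a) + moebiusR R n.+1 * (y - q).
    by rewrite /moebiusR; ring.
  apply: (le_trans (ler_normD _ _)); rewrite -[leRHS]natr1 lerD// normrM -[leRHS]mulr1.
  by apply: ler_pM; rewrite ?moebiusR_norm// ger0_norm; lra.
have hd := log_step_ge0 (ltac:(lia) : (0 < Z.of_nat n)%coqZ).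
have := log_step_bound n0; move: (log_step _) (log_slack _) hd => D G hd hb.
rewrite logsumN1S (zrD w) (zrD (r + _)) (zrD r) !zrM zrD zr_abs zr_nat mulrDr.
have -> : zr scale ^+ 2 * logsumN 1 n + zr scale ^+ 2 * (logsumN 0 n * (ln n.+1%:R - ln n%:R)) -
   (zr w + zr a * zr D) =
   (zr scale ^+ 2 * logsumN 1 n - zr w) +
   ((zr scale * logsumN 0 n) * (zr scale * (ln n.+1%:R - ln n%:R)) - zr a * zr D).
  by ring.
apply: (le_trans (ler_normD _ _)); rewrite -addrA lerD//.
by apply: mul_err => //; rewrite -zr0 zr_le; apply/Z.leb_le.
Qed.

Lemma run_inv chk k n t t' : (0 < n)%N -> (n + k < 97 * 97)%N -> table_inv n t ->
  run chk k t = (t', true) -> table_inv (n + k) t' /\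
  forall i, (n < i <= n + k)%N -> exists2 u, table_inv i u & chk u.
Proof.
elim: k n t => [|k IH] n t n0 nk ht /=.
  by move=> [<-]; rewrite addn0; split=> // i; lia.
case: ifP => // ck /IH; rewrite -addSnnS => /(_ n.+1 isT) [||h1 h2]; first by lia.
  by apply: step_inv => //; lia.
split=> // i /andP[ni ink]; have [->|ni'] := eqVneq i n.+1.
  by exists (step t) => //; apply: step_inv => //; lia.
by apply: h2; lia.
Qed.

Definition state1 := State 1 scale 0 0.

Lemma inv1 : table_inv 1 state1.
Proof.
split => //=; rewrite /logsumN big_nat1 /moebiusR moebius1 divr1 ?subrr ?expr0 ?expr1 ?mulr0 ?mulr1.
  by rewrite subrr normr0.
by rewrite zr0 subrr normr0.
Qed.

End Table.

(* eh ~ scale * H_n, el ~ scale * log n with error ele, ev ~ scale^3 * sum_{j <= n}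
   mu(j)/j log^2(n/j) with error eve, eb = sum_{j <= n} |mu(j)| j; see [ext_inv]. *)
Record ext := Ext { eh : Z; el : Z; ele : Z; ev : Z; eve : Z; eb : Z }.

(** The update of [ev] is [logsumN2S], which takes L at both ends of the step. *)
Definition ext_step (p : state * ext) : state * ext :=
  let (t, e) := p in
  let t' := step t in
  let d := log_step (tn t) in
  let g := log_slack (tn t) in
  let s := (tw t + tw t')%coqZ in
  (t', Ext (eh e + scale / tn t') (el e + d) (ele e + g)
     (ev e + d * s) (eve e + ((tr t + tr t') * (d + g) + Z.abs s * g))
     (eb e + Z.abs (moebius_trial zprimes_lt97 1 (tn t')) * tn t')).

Lemma ext_stepE t e : (ext_step (t, e)).2 =
  Ext (eh e + scale / tn (step t)) (el e + log_step (tn t)) (ele e + log_slack (tn t))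
    (ev e + log_step (tn t) * (tw t + tw (step t)))
    (eve e + ((tr t + tr (step t)) * (log_step (tn t) + log_slack (tn t))
                + Z.abs (tw t + tw (step t)) * log_slack (tn t)))
    (eb e + Z.abs (moebius_trial zprimes_lt97 1 (tn (step t))) * tn (step t)).
Proof. reflexivity. Qed.

Definition ext1 := Ext scale 0 0 0 0 1.

(** Tests on the certified interval around L(n): it is nonnegative and at most 1.00303, at most 1
    for n <= 5, and at least 9/10 for n >= 5. The last two serve the case k = 2. *)
Definition check_small (t : state) : bool :=
  [&& (0 <=? tw t - tr t)%coqZ,
      ((tw t + tr t) * 100000 <=? 100303 * (scale * scale))%coqZ,
      (5 <? tn t)%coqZ || (tw t + tr t <=? scale * scale)%coqZ &
      (tn t <? 5)%coqZ || (9 * (scale * scale) <=? 10 * (tw t - tr t))%coqZ].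

(** Evaluated here, so that later computations start from numerals. L(1119) is within 1/10^5 of 1,
    which makes the coefficient of log t in E tiny. *)
Definition ext1119 := Eval vm_compute in iter (Z.to_nat 1118) ext_step (state1, ext1).

Definition state1119 := ext1119.1.
Definition e1119 := ext1119.2.

Definition check_large (t : state) : bool :=
  ((Z.abs (tw t - tw state1119) + tr t + tr state1119) * 1000000
     <=? 395 * (scale * scale))%coqZ.

Lemma run_small : run check_small (Z.to_nat 1118) state1 = (state1119, true).
Proof. by vm_compute. Qed.

(** The 7 N steps from N = 1119 end at 8 N = 8952, still below the limit 97^2 of
    [moebius_trial97]. *)
Lemma run_large : (run check_large (Z.to_nat 7833) state1119).2 = true.
Proof. by vm_compute. Qed.

Lemma iter_ext1119 : iter (Z.to_nat 1118) ext_step (state1, ext1) = (state1119, e1119).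
Proof. by vm_compute. Qed.

(** * Inequalities read off from the tables *)

Section TableFacts.
Variable R : realType.
Local Notation zr := (zr R).
Local Notation logsumN := (logsumN R).

Definition ext_inv (n : nat) (e : ext) :=
  [/\ zr (eh e) <= zr scale * harm R n <= zr (eh e) + n%:R,
      zr (el e) <= zr scale * ln n%:R <= zr (el e) + zr (ele e),
      `|zr scale ^+ 3 * logsumN 2 n - zr (ev e)| <= zr (eve e) &
      zr (eb e) = \sum_(1 <= j < n.+1) `|moebiusR R j| * j%:R].

Lemma ext_inv1 : ext_inv 1 ext1.
Proof.
split; rewrite /=.
- by rewrite /harm big_nat1 invr1 mulr1 lexx /= lerDl.
- by rewrite ln1 mulr0 zr0 addr0 lexx.
- by rewrite /logsumN big_nat1 ln1 subrr expr0n !mulr0 zr0 subrr normr0.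
- by rewrite big_nat1 /moebiusR moebius1 normr1 mulr1 zr1.
Qed.

Lemma ext_intro n h l le v ve b :
  zr h <= zr scale * harm R n <= zr h + n%:R ->
  zr l <= zr scale * ln n%:R <= zr l + zr le ->
  `|zr scale ^+ 3 * logsumN 2 n - zr v| <= zr ve ->
  zr b = \sum_(1 <= j < n.+1) `|moebiusR R j| * j%:R ->
  ext_inv n (Ext h l le v ve b).
Proof. by split. Qed.

Lemma ext_step_inv n t e : (0 < n < 97 * 97 - 1)%N -> table_inv R n t -> ext_inv n e ->
  table_inv R n.+1 (ext_step (t, e)).1 /\ ext_inv n.+1 (ext_step (t, e)).2.
Proof.
move=> n1; have n1' : (0 < n.+1 < 97 * 97)%N by lia.
move=> it [h1 h2 h3 h4]; have := step_inv n1 it => it'; split => //.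
have /andP[n0 n97] := n1.
have [tn1 _ w1] := it; have [tn2 _ w2] := it'.
rewrite ext_stepE tn1 tn2.
have hd := log_step_ge0 (ltac:(lia) : (0 < Z.of_nat n)%coqZ).
have := log_step_bound R n0; move: (log_step _) (log_slack _) hd => D G hd hb.
move: (tw t) (tr t) w1 => w r w1; move: (tw _) (tr _) w2 => w' r' w2.
have hd' : 0 <= zr D by rewrite -zr0 zr_le; apply/Z.leb_le.
apply: ext_intro.
- have := @zr_div R scale (Z.of_nat n.+1) (Pos2Z.is_pos _).
  rewrite zrD zr_nat harmS mulrDr.
  move: (zr (_ / _)) (zr scale / n.+1%:R) => q y /andP[q1 q2]; rewrite -[n.+1%:R]natr1.
  by move/andP: h1 => [h11 h12]; apply/andP; split; lra.
- rewrite !zrD; move/andP: h2 => [h21 h22]; move/andP: hb.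
  rewrite mulrBr; move: (zr scale * _) (zr scale * _) h21 h22 => x y *; apply/andP; split; lra.
- move: (ev e) (eve e) h3 => v ve h3; rewrite logsumN2S !zrD !zrM zr_abs !zrD.
  have -> : zr scale ^+ 3 * (logsumN 2 n + (ln n.+1%:R - ln n%:R) * (logsumN 1 n + logsumN 1 n.+1)) -
     (zr v + zr D * (zr w + zr w')) = (zr scale ^+ 3 * logsumN 2 n - zr v) +
     ((zr scale ^+ 2 * logsumN 1 n + zr scale ^+ 2 * logsumN 1 n.+1) * (zr scale * (ln n.+1%:R - ln n%:R))
        - (zr w + zr w') * zr D) by ring.
  apply: (le_trans (ler_normD _ _)); rewrite lerD//.
  apply: mul_err => //; rewrite opprD addrACA.
  by apply: (le_trans (ler_normD _ _)); rewrite lerD.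
- rewrite (moebius_trial97 n1') zrD zrM zr_nat zr_abs zr_int h4.
  by rewrite [RHS]big_nat_recr.
Qed.

Lemma ext1119_inv : table_inv R 1119 state1119 /\ ext_inv 1119 e1119.
Proof.
have H k : (k < 97 * 97 - 2)%N -> table_inv R k.+1 (iter k ext_step (state1, ext1)).1 /\
   ext_inv k.+1 (iter k ext_step (state1, ext1)).2.
  elim: k => [_|k IH k97]; first by split; [exact: inv1|exact: ext_inv1].
  have [h1 h2] := IH (ltnW k97); rewrite iterS.
  move: (iter _ _ _) h1 h2 => [t e]; apply: ext_step_inv.
  by move: k97; lia.
have := H (Z.to_nat 1118) ltac:(lia); rewrite iter_ext1119.
by have -> : (Z.to_nat 1118).+1 = 1119 by lia.
Qed.

Lemma table_small i : (1 < i <= 1119)%N -> exists2 t, table_inv R i t & check_small t.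
Proof.
move=> i1; have := run_inv (n := 1) (k := Z.to_nat 1118) isT _ (inv1 R) run_small.
by case=> [|_]; [lia|apply; lia].
Qed.

Lemma table_large i : (1119 < i <= 8 * 1119)%N -> exists2 t, table_inv R i t & check_large t.
Proof.
move=> i1; have [h _] := ext1119_inv.
have E : run check_large (Z.to_nat 7833) state1119 = ((run check_large (Z.to_nat 7833) state1119).1, true).
  by rewrite [LHS]surjective_pairing run_large.
have := run_inv (n := 1119) (k := Z.to_nat 7833) isT _ h E.
by case=> [|_]; [lia|apply; lia].
Qed.

Let x0 := zr_scale_gt0 R.
Let x2 : 0 < zr scale ^+ 2. Proof. exact: exprn_gt0. Qed.

Let z100000 : zr 100000 = 10 ^+ 5. Proof. by rewrite !zrE; lra. Qed.
Let z1000000 : zr 1000000 = 10 ^+ 6. Proof. by rewrite !zrE; lra. Qed.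
Let z10000000 : zr 10000000 = 10 ^+ 7. Proof. by rewrite !zrE; lra. Qed.
Let z100303 : zr 100303 = 10 ^+ 5 + 303. Proof. by rewrite !zrE; lra. Qed.
Let z395 : zr 395 = 395. Proof. by rewrite !zrE; lra. Qed.
Let z9 : zr 9 = 9. Proof. by rewrite !zrE; lra. Qed.
Let z10 : zr 10 = 10. Proof. by rewrite !zrE; lra. Qed.
Let z4 : zr 4 = 4. Proof. by rewrite !zrE; lra. Qed.
Let z314 : zr 314 = 314. Proof. by rewrite !zrE; lra. Qed.
Let z1000 : zr 1000 = 1000. Proof. by rewrite !zrE; lra. Qed.
Let z1197 : zr 1197 = 1197. Proof. by rewrite !zrE; lra. Qed.
Let z1200 : zr 1200 = 1200. Proof. by rewrite !zrE; lra. Qed.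

Lemma zr_le_imp a b : (a <=? b)%coqZ -> zr a <= zr b.
Proof. by rewrite zr_le. Qed.

Lemma logsumN1_small i : (1 < i <= 1119)%N ->
  [/\ 0 <= logsumN 1 i, logsumN 1 i <= 1 + 303 / 10 ^+ 5, (i <= 5)%N -> logsumN 1 i <= 1 &
      (5 <= i)%N -> 9 / 10 <= logsumN 1 i].
Proof.
move=> /table_small[t [tnE _]].
rewrite ler_norml => /andP[h1 h2] /and4P[c1 c2 c3 c4].
have := zr_le_imp c1; have := zr_le_imp c2.
rewrite zr0 zrB !zrM zrD z100000 z100303.
rewrite tnE in c3 c4.
have c3' : (i <= 5)%N -> zr (tw t) + zr (tr t) <= zr scale * zr scale.
  move=> i5; move: c3; case: Z.ltb_spec => [i5'|_ ch]; first by clear -i5 i5'; lia.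
  by rewrite -zrD -zrM; apply: zr_le_imp.
have c4' : (5 <= i)%N -> 9 * (zr scale * zr scale) <= 10 * (zr (tw t) - zr (tr t)).
  move=> i5; move: c4; case: Z.ltb_spec => [i5'|_ ch]; first by clear -i5 i5'; lia.
  by have := zr_le_imp ch; rewrite !zrM zrB z9 z10.
clear c1 c2 c3 c4; move: (zr (tw t)) (zr (tr t)) h1 h2 c3' c4' => w r h1 h2 c3 c4 c2 c1.
move: x2; move: (zr scale) (logsumN 1 i) h1 h2 c1 c2 c3 c4 => X y h1 h2 c1 c2 c3 c4 X2.
split.
- by rewrite -(pmulr_rge0 _ X2); lra.
- by rewrite -(ler_pM2l X2); lra.
- by move=> /c3 ?; rewrite -(ler_pM2l X2); lra.
- by move=> /c4 ?; rewrite -(ler_pM2l X2); lra.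
Qed.

Lemma logsumN1_1119 : `|logsumN 1 1119 - 1| <= 1 / 10 ^+ 5.
Proof.
have [[_ _ h] _] := ext1119_inv.
have c : ((Z.abs (tw state1119 - scale * scale) + tr state1119) * 100000 <=? scale * scale)%coqZ.
  by vm_compute.
move: c => /zr_le_imp; rewrite !zrM zrD zr_abs zrB zrM z100000.
move: (zr (tw _)) (zr (tr _)) h => w r h c.
rewrite -(ler_pM2l x2) -[X in X * `|_|](ger0_norm (ltW x2)) -normrM.
rewrite (_ : zr scale ^+ 2 * (logsumN 1 1119 - 1) = (zr scale ^+ 2 * logsumN 1 1119 - w) + (w - zr scale * zr scale)); last by ring.
by apply: (le_trans (ler_normD _ _)); lra.
Qed.

Lemma logsumN1_large i : (1119 <= i <= 8 * 1119)%N -> `|logsumN 1 i - logsumN 1 1119| <= 395 / 10 ^+ 6.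
Proof.
move=> /andP[]; rewrite leq_eqVlt => /orP[/eqP<- _|i1 i2].
  by rewrite subrr normr0; lra.
have [[_ _ h1] _] := ext1119_inv.
have [|t [_ _ h2]] := @table_large i; first by rewrite i1.
rewrite /check_large => /zr_le_imp; rewrite !zrM !zrD zr_abs zrB z1000000 z395.
move: (zr (tw state1119)) (zr (tr state1119)) (zr (tw t)) (zr (tr t)) h1 h2 => w r w' r' h1 h2 c.
rewrite -(ler_pM2l x2) -[X in X * `|_|](ger0_norm (ltW x2)) -normrM.
rewrite (_ : zr scale ^+ 2 * (logsumN 1 i - logsumN 1 1119) =
  (zr scale ^+ 2 * logsumN 1 i - w') + ((w' - w) - (zr scale ^+ 2 * logsumN 1 1119 - w))); last by ring.
apply: (le_trans (ler_normD _ _)).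
have := ler_normB (w' - w) (zr scale ^+ 2 * logsumN 1 1119 - w).
lra.
Qed.

(** This quantity multiplies the errors of order 1/t^2 in [hlog_err_sum_bound]. The sum over
    squarefree j is close to 3/pi^2 times N^2. *)
Lemma sqfree_1119 : \sum_(1 <= j < 1120) `|moebiusR R j| * j%:R + 1119 ^+ 2 * `|logsumN 0 1119|
  <= 314 / 1000 * 1119 ^+ 2.
Proof.
have [[_ + _] [_ _ _ <-]] := ext1119_inv.
have c : (1000 * (Z.of_nat 1119 * Z.of_nat 1119 * (Z.abs (ta state1119) + Z.of_nat 1119) + eb e1119 * scale)
    <=? 314 * (Z.of_nat 1119 * Z.of_nat 1119) * scale)%coqZ.
  by vm_compute.
move: c => /zr_le_imp; rewrite !zrM zrD !zrM zrD zr_abs !zr_nat z1000 z314.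
move: (zr (ta _)) (zr (eb _)) => a b c h.
rewrite -(ler_pM2l x0) mulrDr.
have : zr scale * `|logsumN 0 1119| <= `|a| + 1119.
  rewrite -[X in X * `|_|](ger0_norm (ltW x0)) -normrM -[X in `|X|](subrK a).
  by apply: (le_trans (ler_normD _ _)); rewrite addrC; lra.
nra.
Qed.

(** Apart from the factor L(N) of g, this is the constant term of E in [remainder_asymp]. *)
Lemma kappa_1119 (g : R) :
  gamma_up R 1119 - (6 * 1119%:R * (1119%:R + 1))^-1 <= g <= gamma_up R 1119 ->
  `|ln 1119%:R - logsumN 2 1119 / 2 - g| <= 6 / 10 ^+ 5.
Proof.
have e1 : (6 * 1119%:R * (1119%:R + 1))^-1 <= 3 / (2 * 10 ^+ 7) :> R.
  by rewrite invf_ple ?posrE; lra.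
have [_ [h1 h2 h3 _]] := ext1119_inv.
have h4 := @log_step_bound R 1119 isT.
(* With [gamma_up] written out for g, twice the quantity is 4 log N + log((N + 1)/N) - 2 H_N -
   [logsumN 2 N]. The upper test has 1197 instead of 1200 to leave room for the uncertainty 3/(2
   10^7) of g. *)
have cu : (10000000 * (scale * scale * (4 * (el e1119 + ele e1119) - 2 * eh e1119
     + (log_step (Z.of_nat 1119) + log_slack (Z.of_nat 1119))) - (ev e1119 - eve e1119))
   <=? 1197 * (scale * scale * scale))%coqZ by vm_compute.
have cl : (0 <=? 1200 * (scale * scale * scale) + 10000000 * (scale * scale *
   (4 * el e1119 - 2 * (eh e1119 + Z.of_nat 1119) + log_step (Z.of_nat 1119)) - (ev e1119 + eve e1119)))%coqZ
  by vm_compute.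
have {cu} := zr_le_imp cu; have {cl} := zr_le_imp cl.
move: (log_step _) (log_slack _) (eh _) (el _) (ele _) (ev _) (eve _) h1 h2 h3 h4 => D G h l le v ve.
move=> /andP[h11 h12] /andP[h21 h22]; rewrite ler_norml => /andP[h31 h32] /andP[h41 h42].
rewrite /gamma_up zr0 !(zrD, zrB, zrM) !zr_nat z10000000 z1197 z1200 z4 zr2.
move: (zr scale) (zr D) (zr G) (zr h) (zr l) (zr le) (zr v) (zr ve) (logsumN 2 1119) (ln 1119%:R : R) (ln 1120%:R : R) (harm R 1119) x0 x2
  h11 h12 h21 h22 h31 h32 h41 h42.
move=> X D' G' h' l' le' v' ve' s2 a b H X0 X2 h11 h12 h21 h22 h31 h32 h41 h42 + + /andP[g1 g2].
have X3 : 0 < X ^+ 3 by exact: exprn_gt0.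
have m1 : X ^+ 2 * h' <= X ^+ 2 * (X * H) by rewrite ler_pM2l.
have m2 : X ^+ 2 * (X * H) <= X ^+ 2 * (h' + 1119%:R) by rewrite ler_pM2l.
have m3 : X ^+ 2 * l' <= X ^+ 2 * (X * a) by rewrite ler_pM2l.
have m4 : X ^+ 2 * (X * a) <= X ^+ 2 * (l' + le') by rewrite ler_pM2l.
have m5 : X ^+ 2 * D' <= X ^+ 2 * (X * (b - a)) by rewrite ler_pM2l// -subr_ge0.
have m6 : X ^+ 2 * (X * (b - a)) <= X ^+ 2 * (D' + G') by rewrite ler_pM2l// -lerBlDl.
have g1' : X ^+ 3 * (H - (a + b) / 2 - 3 / (2 * 10 ^+ 7)) <= X ^+ 3 * g by rewrite ler_pM2l//; lra.
have g2' : X ^+ 3 * g <= X ^+ 3 * (H - (a + b) / 2) by rewrite ler_pM2l//; lra.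
clear h11 h12 h21 h22 h41 h42 g1 g2 e1 X0 X2 => cl cu.
rewrite ler_norml; apply/andP; split; rewrite -(ler_pM2l X3); lra.
Qed.

End TableFacts.

(** * The remainder in the Möbius inversion of a truncated sum *)

Section Tail.
Variable R : realType.
Implicit Types (x t u : R).
Local Notation logsumN := (logsumN R).
Local Notation mu := (moebiusR R).

(** L is affine in log x on the cell around x, hence lies between its values at the two ends. *)
Lemma logsum1_between x (lo hi : R) : 1 <= x ->
  lo <= logsumN 1 (Num.truncn x) <= hi -> lo <= logsumN 1 (Num.truncn x).+1 <= hi ->
  lo <= logsum 1 x <= hi.
Proof.
move=> x1; rewrite logsum1_trunc// logsumN1S.
set T := Num.truncn x.
have T0 : (0 < T)%N by rewrite truncn_gt0.
have TR : 0 < T%:R :> R by rewrite ltr0n.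
have /andP[Tx xT] : T%:R <= x < T.+1%:R by apply: truncn_itv; lra.
have d1 : 0 <= ln x - ln T%:R by rewrite subr_ge0 ler_ln ?posrE//; lra.
have d2 : ln x - ln T%:R <= ln T.+1%:R - ln T%:R.
  by rewrite lerD2r ler_ln ?posrE ?ltr0n//; lra.
move: (logsumN 1 T) (logsumN 0 T) (ln x - ln T%:R) (ln T.+1%:R - ln T%:R) d1 d2 => l m d e d1 d2.
move=> /andP[a1 a2] /andP[b1 b2].
have [m0|m0] := leP 0 m.
  have : m * d <= m * e by rewrite ler_wpM2l.
  have : 0 <= m * d by rewrite mulr_ge0.
  by move=> *; apply/andP; split; lra.
have : m * e <= m * d by rewrite ler_wnM2l// ltW.
have : m * d <= 0 by rewrite mulr_le0_ge0// ltW.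
by move=> *; apply/andP; split; lra.
Qed.

Lemma sum_inv_le_ln (z b : nat) : (0 < z)%N -> (z <= b)%N ->
  \sum_(z.+1 <= n < b.+1) n%:R^-1 <= ln b%:R - ln z%:R :> R.
Proof.
move=> z0; elim: b => [|b IH]; first by move: z0; case: z.
rewrite leq_eqVlt => /orP[/eqP<-|]; first by rewrite big_geq// subrr.
rewrite ltnS => zb; rewrite big_nat_recr//=.
have b0 : (0 < b)%N by apply: leq_trans zb.
have bR : 0 < b%:R :> R by rewrite ltr0n.
have /andP[+ _] := lnS_bounds R b0.
suff h : b.+1%:R^-1 <= 2 / (2 * b%:R + 1) :> R.
  move=> h'; have := le_trans h h'; have := IH zb.
  move: (\sum_(_ <= _ < _) _) (b.+1%:R^-1) (ln b.+1%:R : R) => s e l; lra.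
rewrite -natr1 ler_pdivlMr; last by lra.
by rewrite mulrC ler_pdivrMr; lra.
Qed.

(** The positive part of log, which turns sums cut off at j <= u into sums over a fixed range. *)
Definition lnp (v : R) : R := if 1 <= v then ln v else 0.

Lemma sum_lnp t (j : nat) : 1 <= t -> (0 < j)%N ->
  \sum_(1 <= m < (Num.truncn t).+1) m%:R^-1 * lnp (t / m%:R / j%:R) = hlog_sum (t / j%:R).
Proof.
move=> t1 j0; have jR : 0 < j%:R :> R by rewrite ltr0n.
rewrite /hlog_sum truncn_divn//; last by lra.
rewrite (sum_ltn_widen _ (leq_div _ _)) [RHS]big_mkcond /= big_nat [RHS]big_nat.
apply: eq_bigr => m /andP[m0 mT]; have mR : 0 < m%:R :> R by rewrite ltr0n.
rewrite /lnp ler_pdivlMr// mul1r ler_pdivlMr// -natrM -truncn_ge_nat; last by lra.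
rewrite leq_divRL// mulnC; case: ifP => _; last by rewrite mulr0.
by rewrite mulrAC.
Qed.

(** The L_N of the overview. *)
Definition capped (N : nat) u := if u < N%:R then logsum 1 u else logsumN 1 N.

(** Beyond N the sum over j <= N is L(N) + [logsumN 0 N] log(u/N); the last term removes this
    growth. *)
Lemma cappedE (N : nat) u : (0 < N)%N -> 1 <= u ->
  capped N u = \sum_(1 <= j < N.+1) mu j / j%:R * lnp (u / j%:R) - logsumN 0 N * lnp (u / N%:R).
Proof.
move=> N0 u1; have NR : 0 < N%:R :> R by rewrite ltr0n.
rewrite /capped; case: ltP => uN.
  rewrite [lnp (u / N%:R)]/lnp ler_pdivlMr// mul1r leNgt uN mulr0 subr0.
  have TN : (Num.truncn u <= N)%N by rewrite -ltnS truncn_lt_nat; [rewrite -natr1|]; lra.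
  rewrite /logsum (sum_ltn_widen _ TN) big_mkcond /= big_nat [RHS]big_nat.
  apply: eq_bigr => j /andP[j0 _]; rewrite expr1 /lnp ler_pdivlMr ?ltr0n// mul1r.
  rewrite truncn_ge_nat; last by lra.
  by case: ifP => _; rewrite ?mulr0.
have -> : lnp (u / N%:R) = ln u - ln N%:R.
  by rewrite /lnp ler_pdivlMr// mul1r uN ln_div ?posrE//; lra.
rewrite /logsumN mulr_suml -sumrB big_nat [RHS]big_nat; apply: eq_bigr => j /andP[j0 jN].
have jR : 0 < j%:R :> R by rewrite ltr0n.
have ju : j%:R <= u by apply: le_trans uN; rewrite ler_nat -ltnS.
rewrite /lnp ler_pdivlMr// mul1r ju ln_div ?posrE//; last by lra.
by rewrite expr0 expr1; ring.
Qed.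

Definition remainder (N : nat) t : R :=
  ln t - \sum_(1 <= m < (Num.truncn t).+1) m%:R^-1 * capped N (t / m%:R).

(** Write L_N(x) by [moebius_inversion] and subtract it from the defining sum of L(x). *)
Lemma logsum1_remainder N x : 1 <= x -> logsum 1 x - capped N x =
  \sum_(1 <= n < (Num.truncn x).+1) mu n / n%:R * remainder N (x / n%:R).
Proof.
move=> x1; rewrite -[capped N x in LHS]moebius_inversion// /logsum -sumrB.
by apply: eq_bigr => n _; rewrite expr1 /remainder mulrBr.
Qed.

(** By [sum_logsum1], E(t) is the sum of (L - L_N)(t/m)/m. Only the m with t/m >= N contribute, and
    t < K N forces m < K. *)
Lemma remainder_bound N (rho : R) (K : nat) t : (0 < N)%N -> 0 <= rho -> 1 <= t ->
  t < (K * N)%:R ->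
  (forall u, N%:R <= u -> u < (K * N)%:R -> `|logsum 1 u - logsumN 1 N| <= rho) ->
  `|remainder N t| <= rho * \sum_(1 <= m < K | (m%:R * N%:R <= t)) m%:R^-1.
Proof.
move=> N0 rho0 t1 tK hr; have NR : 0 < N%:R :> R by rewrite ltr0n.
rewrite /remainder -sum_logsum1// -sumrB.
apply: (le_trans (ler_norm_sum _ _ _)).
have K0 : (0 < K)%N by case: K tK hr => //; rewrite mul0n; lra.
pose T := maxn (Num.truncn t) K.
rewrite (sum_ltn_widen _ (leq_maxl _ K)) -/T.
have -> : \sum_(1 <= m < K | (m%:R * N%:R <= t)) m%:R^-1 =
    \sum_(1 <= m < T.+1 | (m%:R * N%:R <= t)) m%:R^-1 :> R.
  rewrite [RHS](big_cat_nat _ (n := K))//=; last by rewrite ltnW// ltnS leq_maxr.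
  rewrite [X in _ + X]big_nat_cond [X in _ + X]big1 ?addr0// => m /andP[/andP[Km _] mt].
  move: tK; rewrite ltNge (le_trans _ mt)// -natrM ler_nat leq_mul2r Km orbT//.
rewrite mulr_sumr big_mkcond [leRHS]big_mkcond /= big_nat [leRHS]big_nat.
apply: ler_sum => m /andP[m0 mT]; have mR : 0 < m%:R :> R by rewrite ltr0n.
rewrite -mulrBr normrM ger0_norm ?invr_ge0//.
rewrite truncn_ge_nat; last by lra.
rewrite /capped ltNge ler_pdivlMr// mulrC [N%:R * _]mulrC.
case: (boolP (m%:R * N%:R <= t)) => mt; last first.
  by case: ifP => _ //=; rewrite subrr normr0 mul0r.
have mt' : m%:R <= t.
  by apply: le_trans mt; rewrite ler_peMr ?(ltW mR)// ler1n.
rewrite mt' /= ler_wpM2r ?invr_ge0 ?(ltW mR)//.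
apply: hr; first by rewrite ler_pdivlMr// mulrC.
by apply: le_lt_trans tK; rewrite ler_pdivrMr// ler_peMr ?ler1n//; lra.
Qed.

Section Asymptotic.
Variables (g c : R).
Definition hlog_err t := hlog_sum t - (ln t ^+ 2 / 2 + g * ln t + c).

(** Insert [cappedE], exchange the sums, so that each j yields [hlog_sum (t / j%:R)], and expand.
    The squares of log t cancel. *)
Lemma remainder_asymp N t : (0 < N)%N -> N%:R <= t -> remainder N t =
  (1 - logsumN 1 N) * ln (t / N%:R) + (ln N%:R - logsumN 2 N / 2 - g * logsumN 1 N)
  - (\sum_(1 <= j < N.+1) mu j / j%:R * hlog_err (t / j%:R) - logsumN 0 N * hlog_err (t / N%:R)).
Proof.
move=> N0 Nt; have NR : 0 < N%:R :> R by rewrite ltr0n.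
have t1 : 1 <= t by apply: le_trans Nt; rewrite ler1n.
have t0 : 0 < t by lra.
rewrite /remainder.
have -> : \sum_(1 <= m < (Num.truncn t).+1) m%:R^-1 * capped N (t / m%:R) =
   \sum_(1 <= j < N.+1) mu j / j%:R * hlog_sum (t / j%:R) - logsumN 0 N * hlog_sum (t / N%:R).
  under [in RHS]eq_big_nat => j /andP[j0 _] do rewrite -sum_lnp// mulr_sumr.
  rewrite -(sum_lnp t1 N0) mulr_sumr exchange_big_nat/= -sumrB big_nat [RHS]big_nat.
  apply: eq_bigr => m /andP[m0 mT]; have mR : 0 < m%:R :> R by rewrite ltr0n.
  have mt : m%:R <= t by rewrite -truncn_ge_nat ?(ltW t0).
  rewrite cappedE//; last by rewrite ler_pdivlMr// mul1r.
  rewrite mulrBr mulr_sumr; congr (_ - _); last by ring.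
  by apply: eq_bigr => j _; ring.
have W v : hlog_sum v = (ln v ^+ 2 / 2 + g * ln v + c) + hlog_err v by rewrite /hlog_err addrC subrK.
rewrite W; under eq_bigr do rewrite W mulrDr.
rewrite big_split /=.
(* Expand log(t/j) = log(t/N) + log(N/j). The part with [logsumN 0 N] is then cancelled by the
   correction term of [cappedE]. *)
have -> : \sum_(1 <= j < N.+1) mu j / j%:R * (ln (t / j%:R) ^+ 2 / 2 + g * ln (t / j%:R) + c)
   = logsumN 0 N * (ln (t / N%:R) ^+ 2 / 2 + g * ln (t / N%:R) + c)
     + logsumN 1 N * (ln (t / N%:R) + g) + logsumN 2 N / 2.
  rewrite /logsumN !mulr_suml -!big_split /= big_nat [RHS]big_nat.
  apply: eq_bigr => j /andP[j0 _]; have jR : 0 < j%:R :> R by rewrite ltr0n.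
  by rewrite !ln_div ?posrE// expr0 expr1; field; rewrite gt_eqF.
rewrite ln_div ?posrE//; ring.
Qed.

Lemma hlog_err_sum_bound N (cK : R) t : (0 < N)%N -> 0 < t ->
  (forall j, (0 < j <= N)%N -> `|hlog_err (t / j%:R)| <= cK * (j%:R / t) ^+ 2) ->
  `|\sum_(1 <= j < N.+1) mu j / j%:R * hlog_err (t / j%:R) - logsumN 0 N * hlog_err (t / N%:R)|
   <= cK * (\sum_(1 <= j < N.+1) `|mu j| * j%:R + N%:R ^+ 2 * `|logsumN 0 N|) / t ^+ 2.
Proof.
move=> N0 t0 hq.
apply: (le_trans (ler_normB _ _)).
rewrite [cK * (_ + _)]mulrDr mulrDl lerD//.
  apply: (le_trans (ler_norm_sum _ _ _)).
  rewrite mulr_sumr mulr_suml big_nat [leRHS]big_nat ler_sum// => j /andP[j0 jN].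
  have jR : 0 < j%:R :> R by rewrite ltr0n.
  rewrite 2!normrM normfV [`|j%:R|]ger0_norm ?(ltW jR)//.
  have -> : cK * (`|mu j| * j%:R) / t ^+ 2 = `|mu j| / j%:R * (cK * (j%:R / t) ^+ 2).
    by field; rewrite !gt_eqF.
  by rewrite ler_wpM2l ?divr_ge0 ?(ltW jR)// hq// j0.
rewrite normrM.
have -> : cK * (N%:R ^+ 2 * `|logsumN 0 N|) / t ^+ 2 = `|logsumN 0 N| * (cK * (N%:R / t) ^+ 2).
  by field; rewrite gt_eqF.
by rewrite ler_wpM2l// hq// N0 leqnn.
Qed.

End Asymptotic.

(** For v >= K the integer part of v is at least K v / (K + 1), and 1/8 exceeds 1/12. *)
Lemma hlog_err_bound (g c : R) (K : nat) (v : R) : (0 < K)%N -> K%:R <= v ->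
  - (12 * (Num.truncn v)%:R ^+ 2)^-1 <= hlog_err g c v <= (8 * (Num.truncn v)%:R ^+ 2)^-1 ->
  `|hlog_err g c v| <= (K.+1%:R / K%:R) ^+ 2 / 8 / v ^+ 2.
Proof.
move=> K0 Kv; have KR : 0 < K%:R :> R by rewrite ltr0n.
set T := Num.truncn v => /andP[h1 h2].
have v0 : 0 <= v by lra.
have v1 : 0 < v by lra.
have KT : (K <= T)%N by rewrite truncn_ge_nat.
have TR : 0 < T%:R :> R by apply: (lt_le_trans KR); rewrite ler_nat.
have KTR : K%:R <= T%:R :> R by rewrite ler_nat.
have /andP[_ vT] := truncn_itv v0.
have h3 : `|hlog_err g c v| <= (8 * T%:R ^+ 2)^-1.
  rewrite ler_norml h2 andbT; apply: le_trans h1; rewrite lerN2 lef_pV2 ?posrE ?mulr_gt0 ?exprn_gt0//.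
  by rewrite ler_pM2r ?exprn_gt0//; lra.
apply: (le_trans h3).
have -> : (K.+1%:R / K%:R) ^+ 2 / 8 / v ^+ 2 = (8 * (K%:R * v / K.+1%:R) ^+ 2)^-1.
  by field; rewrite !gt_eqF//; lra.
have p : 0 < K%:R * v / K.+1%:R by rewrite divr_gt0// mulr_gt0//; lra.
rewrite lef_pV2 ?posrE ?mulr_gt0 ?exprn_gt0//.
rewrite ler_pM2l; last by lra.
rewrite lerXn2r ?nnegrE ?(ltW p) ?(ltW TR)// ler_pdivrMr ?ltr0n//.
rewrite -natr1 mulrDr mulr1.
have : K%:R * v <= K%:R * (T%:R + 1) by rewrite ler_pM2l// natr1 ltW.
lra.
Qed.

End Tail.

(** * The induction for the bounds on L *)

Section Core.
Variable R : realType.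
Implicit Types (x t u : R).
Local Notation logsumN := (logsumN R).
Local Notation mu := (moebiusR R).

Lemma logsumN1_table i : (0 < i <= 8 * 1119)%N ->
  [/\ 0 <= logsumN 1 i, logsumN 1 i <= 1 + 303 / 10 ^+ 5, (i <= 5)%N -> logsumN 1 i <= 1 &
      (5 <= i)%N -> 9 / 10 <= logsumN 1 i].
Proof.
move=> /andP[i0 i8]; have [->|i1] := eqVneq i 1%N.
  by rewrite /logsumN big_nat1 ln1 subrr expr1 mulr0; clear; split; [|lra|lra|].
have [iN|iN] := leqP i 1119.
  by apply: logsumN1_small; rewrite iN andbT ltn_neqAle eq_sym i1.
have h1 := @logsumN1_large R i _; have {h1} : `|logsumN 1 i - logsumN 1 1119| <= 395 / 10 ^+ 6.
  by apply: h1; rewrite (ltnW iN).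
have := @logsumN1_1119 R; rewrite !ler_norml => /andP[a1 a2] /andP[b1 b2].
have iN5 : (5 <= i)%N by apply: leq_trans iN.
clear -a1 a2 b1 b2 iN iN5; split; [lra|lra| |by move=> _; lra].
by move=> i5; move: (leq_trans iN i5).
Qed.

Lemma truncn_table x : 1 <= x -> x < (8 * 1119)%:R ->
  (0 < Num.truncn x <= 8 * 1119)%N && (0 < (Num.truncn x).+1 <= 8 * 1119)%N.
Proof.
move=> x1 x8; rewrite truncn_gt0 x1 /= truncn_lt_nat; last by lra.
by rewrite x8 andbT ltnW// truncn_lt_nat; lra.
Qed.

Lemma logsum1_table x : 1 <= x -> x < (8 * 1119)%:R ->
  [/\ 0 <= logsum 1 x <= 1 + 303 / 10 ^+ 5, x < 5 -> logsum 1 x <= 1 &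
      5 <= x -> 9 / 10 <= logsum 1 x].
Proof.
move=> x1 x8; have x0 : 0 <= x by lra.
have /andP[/logsumN1_table[a1 a2 a3 a4] /logsumN1_table[b1 b2 b3 b4]] := truncn_table x1 x8.
split.
- by apply: logsum1_between => //; rewrite ?a1 ?b1.
- move=> x5; have T5 : (Num.truncn x < 5)%N by rewrite truncn_lt_nat.
  by have /andP[] := @logsum1_between R x 0 1 x1 ltac:(by rewrite a1 a3// ltnW) ltac:(by rewrite b1 b3).
- move=> x5; have T5 : (5 <= Num.truncn x)%N by rewrite truncn_ge_nat.
  by have /andP[] := @logsum1_between R x (9 / 10) (1 + 303 / 10 ^+ 5) x1 ltac:(by rewrite a4// a2) ltac:(by rewrite b4// leqW).
Qed.

Lemma logsum1_near x : 1119%:R <= x -> x < (8 * 1119)%:R ->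
  `|logsum 1 x - logsumN 1 1119| <= 395 / 10 ^+ 6.
Proof.
move=> xN x8.
have x1 : 1 <= x by apply: le_trans xN; rewrite (ler_nat _ 1).
have x0 : 0 <= x by lra.
have TN : (1119 <= Num.truncn x)%N by rewrite truncn_ge_nat.
have /andP[/andP[_ h1] /andP[_ h2]] := truncn_table x1 x8.
have := @logsumN1_large R (Num.truncn x) ltac:(by rewrite TN).
have := @logsumN1_large R (Num.truncn x).+1 ltac:(by rewrite leqW).
move: (395 / 10 ^+ 6) => rho.
rewrite !ler_norml => /andP[a1 a2] /andP[b1 b2]; clear x8 xN h1 h2 TN x0.
have /andP[c1 c2] := @logsum1_between R x (logsumN 1 1119 - rho) (logsumN 1 1119 + rho) x1
  ltac:(apply/andP; split; lra) ltac:(apply/andP; split; lra).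
by apply/andP; split; lra.
Qed.

(* The cubic bound of [ln_atanh_bounds] at z = (y - 1) / (y + 1), with denominators cleared. *)
Lemma ln_le_cubic (y b : R) : 1 <= y ->
  (y - 1) * (12 * y + (y - 1) ^+ 2) <= b * (6 * y * (y + 1)) -> ln y <= b.
Proof.
move=> y1 yb; have h : 0 <= (y - 1) / (y + 1) < 1.
  by rewrite divr_ge0 ?ltr_pdivrMr//=; lra.
have /andP[_] := ln_atanh_bounds h.
have -> : (1 + (y - 1) / (y + 1)) / (1 - (y - 1) / (y + 1)) = y.
  by field; rewrite !gt_eqF//; lra.
move=> /le_trans; apply.
have -> : 2 * ((y - 1) / (y + 1)) + 2 * ((y - 1) / (y + 1)) ^+ 3 / (3 * (1 - ((y - 1) / (y + 1)) ^+ 2))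
   = (y - 1) * (12 * y + (y - 1) ^+ 2) / (6 * y * (y + 1)).
  by field; rewrite !gt_eqF//; lra.
by rewrite ler_pdivrMr// !mulr_gt0//; lra.
Qed.

Lemma ln2_le : ln 2 <= 25 / 36 :> R.
Proof. by apply: ln_le_cubic; lra. Qed.

(** The total weight of the terms with x/n < 8 N, as it arises in [logsum1_tail_middle]. *)
Lemma ln_weights : \sum_(1 <= m < 8) m%:R^-1 * ln (16 / m%:R) <= 525 / 100 :> R.
Proof.
have l2 := ln2_le.
have h1 : ln (4 / 3) <= 2877 / 10 ^+ 4 :> R.
  by apply: ln_le_cubic; lra.
have h2 : ln (8 / 5) <= 4702 / 10 ^+ 4 :> R.
  by apply: ln_le_cubic; lra.
have h3 : ln (8 / 7) <= 1336 / 10 ^+ 4 :> R.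
  by apply: ln_le_cubic; lra.
have M (b : R) : 0 < b -> ln (2 * b) = ln 2 + ln b by move=> b0; rewrite lnM ?posrE.
do 7 (rewrite big_ltn//); rewrite big_geq//.
have -> : 16 / 1%:R = 2 * (2 * (2 * 2)) :> R by lra.
have -> : 16 / 2%:R = 2 * (2 * 2) :> R by lra.
have -> : 16 / 3%:R = 2 * (2 * (4 / 3)) :> R by lra.
have -> : 16 / 4%:R = 2 * 2 :> R by lra.
have -> : 16 / 5%:R = 2 * (8 / 5) :> R by lra.
have -> : 16 / 6%:R = 2 * (4 / 3) :> R by lra.
have -> : 16 / 7%:R = 2 * (8 / 7) :> R by lra.
rewrite !M//; [|by lra..].
move: (ln 2 : R) (ln (4 / 3) : R) (ln (8 / 5) : R) (ln (8 / 7) : R) l2 h1 h2 h3 => a b d e *.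
by rewrite invr1; lra.
Qed.

Lemma sum_nat_le_sqr (z : nat) : \sum_(1 <= n < z.+1) n%:R <= z%:R ^+ 2 :> R.
Proof.
elim: z => [|z IH]; first by rewrite big_geq// expr0n.
rewrite big_nat_recr//= -natr1; have := ler0n R z; nra.
Qed.

Lemma kappa_bound (g : R) : 0 <= g <= 1 ->
  gamma_up R 1119 - (6 * 1119%:R * (1119%:R + 1))^-1 <= g <= gamma_up R 1119 ->
  `|ln 1119%:R - logsumN 2 1119 / 2 - g * logsumN 1 1119| <= 7 / 10 ^+ 5.
Proof.
move=> /andP[g0 g1] /kappa_1119; have := @logsumN1_1119 R.
rewrite !ler_norml; move: (ln _ : R) (logsumN 2 _) (logsumN 1 _) => l s2 L.
move=> /andP[a1 a2] /andP[b1 b2].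
have h1 : g * (L - 1) <= 1 / 10 ^+ 5.
  apply: (@le_trans _ _ (g * (1 / 10 ^+ 5))); first by rewrite ler_wpM2l.
  by rewrite -[leRHS]mul1r ler_wpM2r//; lra.
have h2 : - (1 / 10 ^+ 5) <= g * (L - 1).
  apply: (@le_trans _ _ (g * - (1 / 10 ^+ 5))); last by rewrite ler_wpM2l.
  by rewrite mulrN lerN2 -[leRHS]mul1r ler_wpM2r//; lra.
by apply/andP; split; lra.
Qed.

(** Here [s1] and [s0] stand for [logsum 1] and [logsum 0] at x/(8 N), and [k] for the constant term
    of E. The two parts are at most 3.1/10^5 and 7/10^5. *)
Lemma tail_numeric (s1 s0 k : R) : 0 <= s1 <= 1 + 303 / 10 ^+ 5 -> `|s0| <= 1 ->
  `|k| <= 7 / 10 ^+ 5 ->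
  `|(1 - logsumN 1 1119) * (s1 + ln 8 * s0) + k * s0| <= 11 / 10 ^+ 5.
Proof.
move=> /andP[s10 s11] s01 k1.
have e8 : ln 8 = ln 2 + (ln 2 + ln 2) :> R by rewrite -!lnM ?posrE//; congr ln; lra.
have l8 : 0 <= (ln 8 : R) <= 2084 / 1000.
  have := ln2_le; have : 0 <= ln 2 :> R by apply: ln_ge0; lra.
  by rewrite e8 => ? ?; apply/andP; split; lra.
have h : `|s1 + ln 8 * s0| <= 31 / 10.
  apply: (le_trans (ler_normD _ _)); rewrite normrM.
  case/andP: l8 => l0 l8.
  have : `|ln 8| * `|s0| <= 2084 / 1000 * 1 by apply: ler_pM => //; rewrite (ger0_norm l0).
  by rewrite (ger0_norm s10); lra.
apply: (le_trans (ler_normD _ _)).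
have h1 : `|(1 - logsumN 1 1119) * (s1 + ln 8 * s0)| <= 1 / 10 ^+ 5 * (31 / 10).
  by rewrite normrM; apply: ler_pM => //; rewrite distrC logsumN1_1119.
have h2 : `|k * s0| <= 7 / 10 ^+ 5 * 1.
  by rewrite normrM; apply: ler_pM.
by move: h1 h2; clear; move: (`|_|) (`|_|) => *; lra.
Qed.

(** These are the n with x/n >= 8 N. As log(x/(n N)) = log(y/n) + log 8 for y = x/(8 N), the affine
    part of E sums to a combination of [logsum 1 y] and [logsum 0 y]. *)
Lemma logsum1_tail_head x (g c : R) (z := (Num.truncn x %/ (8 * 1119))%N) :
  (8 * 1119)%:R <= x ->
  0 <= g <= 1 ->
  gamma_up R 1119 - (6 * 1119%:R * (1119%:R + 1))^-1 <= g <= gamma_up R 1119 ->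
  (forall t, 1 <= t -> - (12 * (Num.truncn t)%:R ^+ 2)^-1 <= hlog_err g c t <= (8 * (Num.truncn t)%:R ^+ 2)^-1) ->
  0 <= logsum 1 (x / (8 * 1119)%:R) <= 1 + 303 / 10 ^+ 5 ->
  `|\sum_(1 <= n < z.+1) mu n / n%:R * remainder 1119 (x / n%:R)| <= 90 / 10 ^+ 5.
Proof.
move=> xK g01 hg hq hy.
have K0 : 0 < (8 * 1119)%:R :> R by rewrite ltr0n.
have x0 : 0 < x by lra.
have N0 : 0 < 1119%:R :> R by rewrite ltr0n.
set y := x / (8 * 1119)%:R in hy *.
have zE : Num.truncn y = z by rewrite truncn_divn// ltW.
pose kap := ln 1119%:R - logsumN 2 1119 / 2 - g * logsumN 1 1119.
pose er t := \sum_(1 <= j < 1120) mu j / j%:R * hlog_err g c (t / j%:R) - logsumN 0 1119 * hlog_err g c (t / 1119%:R).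
have rE n : (0 < n <= z)%N -> remainder 1119 (x / n%:R) =
   (1 - logsumN 1 1119) * (ln (y / n%:R) + ln 8) + kap - er (x / n%:R).
  move=> /andP[n0 nz]; have nR : 0 < n%:R :> R by rewrite ltr0n.
  have nx : (8 * 1119)%:R <= x / n%:R.
    rewrite ler_pdivlMr// -natrM -truncn_ge_nat ?(ltW x0)// mulnC.
    by rewrite -leq_divRL.
  rewrite (remainder_asymp g c)//; last by apply: le_trans nx; rewrite ler_nat.
  rewrite -/kap; congr (_ * _ + _ - _).
  rewrite -lnM ?posrE ?divr_gt0//; congr ln.
  by rewrite /y natrM; field; rewrite !gt_eqF.
have -> : \sum_(1 <= n < z.+1) mu n / n%:R * remainder 1119 (x / n%:R) =
   (1 - logsumN 1 1119) * (logsum 1 y + ln 8 * logsum 0 y) + kap * logsum 0 y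
   - \sum_(1 <= n < z.+1) mu n / n%:R * er (x / n%:R).
  rewrite /logsum zE mulrDr !mulr_sumr -!big_split -sumrB /= big_nat [RHS]big_nat.
  apply: eq_bigr => n /rE ->; rewrite expr0 expr1; ring.
(* As x/(n j) >= 8, [hlog_err_bound] applies with K = 8, and (9/8)^2 / 8 times the 314/1000 of
   [sqfree_1119] is below 5/100. *)
have er_le n : (0 < n <= z)%N -> `|er (x / n%:R)| <= 5 / 100 * 1119%:R ^+ 2 * n%:R ^+ 2 / x ^+ 2.
  move=> /andP[n0 nz]; have nR : 0 < n%:R :> R by rewrite ltr0n.
  have nx : (8 * 1119)%:R <= x / n%:R.
    rewrite ler_pdivlMr// -natrM -truncn_ge_nat ?(ltW x0)// mulnC.
    by rewrite -leq_divRL.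
  have xn0 : 0 < x / n%:R by rewrite divr_gt0.
  apply: (@le_trans _ _ ((9%:R / 8%:R) ^+ 2 / 8 * (\sum_(1 <= j < 1120) `|mu j| * j%:R + 1119%:R ^+ 2 * `|logsumN 0 1119|) / (x / n%:R) ^+ 2)).
    apply: hlog_err_sum_bound => // j /andP[j0 jN]; have jR : 0 < j%:R :> R by rewrite ltr0n.
    have v8 : 8%:R <= x / n%:R / j%:R.
      rewrite ler_pdivlMr//; apply: le_trans nx; rewrite natrM ler_pM2l ?ltr0n// ler_nat//.
    have := @hlog_err_bound R g c 8 _ isT v8 (hq _ _).
    rewrite [(x / n%:R / j%:R)]lock => h; apply: (le_trans (h _)).
      by rewrite -lock; apply: le_trans v8; rewrite ler1n.
    rewrite -lock le_eqVlt; apply/orP; left; apply/eqP.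
    by field; rewrite !gt_eqF.
  have s := sqfree_1119 R.
  have -> : 5 / 100 * 1119%:R ^+ 2 * n%:R ^+ 2 / x ^+ 2 = (5 / 100 * 1119%:R ^+ 2) / (x / n%:R) ^+ 2.
    by field; rewrite !gt_eqF.
  rewrite ler_wpM2r ?invr_ge0 ?exprn_ge0 ?(ltW xn0)//.
  move: s; move: (\sum_(_ <= _ < _) _ + _) => S s; clear -s; lra.
(* The sum of the n up to z is at most z^2, and 8 N z <= x; hence the 64. *)
have ersum : `|\sum_(1 <= n < z.+1) mu n / n%:R * er (x / n%:R)| <= 5 / 100 / 64.
  apply: (le_trans (ler_norm_sum _ _ _)).
  apply: (@le_trans _ _ (\sum_(1 <= n < z.+1) (5 / 100 * 1119%:R ^+ 2 / x ^+ 2) * n%:R)).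
    rewrite big_nat [leRHS]big_nat ler_sum// => n nz.
    have n0 : (0 < n)%N by case/andP: nz.
    have nR : 0 < n%:R :> R by rewrite ltr0n.
    rewrite 2!normrM normfV [`|n%:R|]ger0_norm ?(ltW nR)//.
    apply: (@le_trans _ _ (1 / n%:R * (5 / 100 * 1119%:R ^+ 2 * n%:R ^+ 2 / x ^+ 2))).
      apply: ler_pM => //; last exact: er_le.
      by rewrite ler_pM2r ?invr_gt0// moebiusR_norm.
    by rewrite le_eqVlt; apply/orP; left; apply/eqP; field; rewrite !gt_eqF.
  rewrite -mulr_sumr; apply: (le_trans (ler_wpM2l _ (sum_nat_le_sqr z))).
    by rewrite divr_ge0 ?mulr_ge0 ?divr_ge0 ?exprn_ge0 ?ler0n// ltW.
  have zx : z%:R * (8 * 1119)%:R <= x.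
    rewrite -natrM -truncn_ge_nat ?(ltW x0)//; exact: leq_divM.
  rewrite natrM in zx; move: (1119%:R : R) (z%:R : R) N0 (ler0n R z) zx => N Z N0 Z0 zx.
  have Z8 : 0 <= Z * (8 * N) by rewrite !mulr_ge0// ltW.
  have : (Z * (8 * N)) ^+ 2 <= x ^+ 2 by rewrite lerXn2r// nnegrE ltW.
  by rewrite mulrAC ler_pdivrMr ?exprn_gt0//; clear; lra.
apply: (le_trans (ler_normB _ _)).
have := tail_numeric hy (logsum0_le1 y) (kappa_bound g01 hg).
rewrite -/kap; move: ersum; clear.
by move: (`|_|) (`|_|) => a b *; lra.
Qed.

(** Here x/n < 8 N, so [remainder_bound] applies with K = 8. After exchanging the sums, the n
    belonging to a given m run from z + 1 to Y, and their reciprocals sum to at most log(Y/z) <=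
    log(16/m). *)
Lemma logsum1_tail_middle x (z := (Num.truncn x %/ (8 * 1119))%N) :
  (8 * 1119)%:R <= x ->
  `|\sum_(z.+1 <= n < (Num.truncn x).+1) mu n / n%:R * remainder 1119 (x / n%:R)|
    <= 395 / 10 ^+ 6 * (525 / 100).
Proof.
move=> xK; set T := Num.truncn x in z *.
have K0 : 0 < (8 * 1119)%:R :> R by rewrite ltr0n.
have x0 : 0 < x by lra.
have KT : (8 * 1119 <= T)%N by rewrite truncn_ge_nat// ltW.
have z0 : (0 < z)%N by rewrite divn_gt0.
have zR : 0 < z%:R :> R by rewrite ltr0n.
have rho0 : 0 <= 395 / 10 ^+ 6 :> R by lra.
apply: (le_trans (ler_norm_sum _ _ _)).
apply: (@le_trans _ _ (\sum_(z.+1 <= n < T.+1) 395 / 10 ^+ 6 *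
   (\sum_(1 <= m < 8) if m%:R * 1119%:R <= x / n%:R then n%:R^-1 * m%:R^-1 else 0))).
  rewrite big_nat [leRHS]big_nat ler_sum// => n /andP[zn nT].
  have n0 : (0 < n)%N by apply: leq_trans zn.
  have nR : 0 < n%:R :> R by rewrite ltr0n.
  have xn1 : 1 <= x / n%:R by rewrite ler_pdivlMr// mul1r -truncn_ge_nat ?(ltW x0).
  have xnK : x / n%:R < (8 * 1119)%:R.
    rewrite ltr_pdivrMr// -natrM -truncn_lt_nat ?(ltW x0)//.
    by rewrite mulnC -ltn_divLR.
  have := remainder_bound (N := 1119) isT rho0 xn1 xnK logsum1_near.
  move=> h; rewrite 2!normrM normfV [`|n%:R|]ger0_norm ?(ltW nR)//.
  apply: (@le_trans _ _ (1 / n%:R * (395 / 10 ^+ 6 * \sum_(1 <= m < 8 | m%:R * 1119%:R <= x / n%:R) m%:R^-1))).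
    by apply: ler_pM => //; rewrite ?divr_ge0 ?(ltW nR)// ler_pM2r ?invr_gt0// moebiusR_norm.
  rewrite div1r mulrCA ler_wpM2l// mulr_sumr big_mkcond /=.
  by rewrite le_eqVlt; apply/orP; left.
rewrite -mulr_sumr ler_wpM2l// exchange_big_nat/=.
apply: le_trans ln_weights; rewrite big_nat [leRHS]big_nat ler_sum// => m /andP[m0 m8].
have mR : 0 < m%:R :> R by rewrite ltr0n.
have mN0 : (0 < m * 1119)%N by rewrite muln_gt0 m0.
rewrite -big_mkcond /=.
pose Y := (T %/ (m * 1119))%N.
have zY : (z <= Y)%N by rewrite leq_div2l// leq_mul2r ltnW.
have YT : (Y <= T)%N by rewrite leq_div.
have Y0 : (0 < Y)%N by apply: leq_trans zY.
have -> : \sum_(z.+1 <= n < T.+1 | m%:R * 1119%:R <= x / n%:R) n%:R^-1 * m%:R^-1 =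
    m%:R^-1 * \sum_(z.+1 <= n < Y.+1) n%:R^-1 :> R.
  rewrite mulr_sumr (big_cat_nat _ (n := Y.+1))//=.
  rewrite [X in _ + X]big_nat_cond [X in _ + X]big1 ?addr0; last first.
    move=> n /andP[/andP[Yn _] mn]; have n0 : (0 < n)%N by apply: leq_ltn_trans Yn.
    move: mn; rewrite ler_pdivlMr ?ltr0n// -!natrM -truncn_ge_nat ?(ltW x0)// mulnC -leq_divRL//.
    by rewrite leqNgt Yn.
  rewrite big_nat_cond [RHS]big_nat_cond; apply: eq_big => [n|n _]; last by rewrite mulrC.
  case: (boolP (z < n < Y.+1)%N) => //= /andP[zn nY].
  have n0 : (0 < n)%N by apply: leq_trans zn.
  by rewrite ler_pdivlMr ?ltr0n// -!natrM -truncn_ge_nat ?(ltW x0)// mulnC -leq_divRL.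
rewrite ler_pM2l ?invr_gt0//.
apply: (le_trans (sum_inv_le_ln R z0 zY)).
rewrite -ln_div ?posrE ?ltr0n// ler_ln ?posrE ?divr_gt0 ?ltr0n//.
rewrite ler_pdivrMr// mulrAC ler_pdivlMr// -!natrM ler_nat.
(* Y m N <= T < (z + 1) 8 N <= 16 z N, the last step because z >= 1. *)
have h1 : (Y * (m * 1119) <= T)%N by exact: leq_divM.
have h2 : (T < z.+1 * (8 * 1119))%N by apply: ltn_ceil.
rewrite -(leq_pmul2r (isT : 0 < 1119)%N) -mulnA; apply: (leq_trans h1).
apply: (leq_trans (ltnW h2)).
have : (z.+1 <= 2 * z)%N by move: z0; clear; lia.
rewrite -(leq_pmul2r (isT : 0 < 8 * 1119)%N) => /leq_trans; apply.
by rewrite leq_eqVlt; apply/orP; left; apply/eqP; rewrite mulnA; ring.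
Qed.

Lemma logsum1_bounds x : 1 <= x ->
  [/\ 0 <= logsum 1 x <= 1 + 303 / 10 ^+ 5, x < 5 -> logsum 1 x <= 1 &
      5 <= x -> 9 / 10 <= logsum 1 x].
Proof.
have [g [c [hg _ hq]]] := harmonic_log_expansion R.
have g01 : 0 <= g <= 1.
  have /andP[a b] := hg 1%N isT; move: a b; rewrite /gamma_up /harm big_nat1 ln1 add0r invr1 (_ : 6 * 1%:R * (1%:R + 1) = 12); last by lra.
  have := ln2_le; have : 0 <= ln 2 :> R by apply: ln_ge0; lra.
  by move=> *; apply/andP; split; lra.
(* Strong induction on the integer part: the bounds at x use those at x/(8 N). *)
have [n] := ubnP (Num.truncn x); elim: n x => // n IH x xn x1.
have [x8|x8] := ltP x (8 * 1119)%:R; first exact: logsum1_table.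
have K0 : 0 < (8 * 1119)%:R :> R by rewrite ltr0n.
have T0 : (0 < Num.truncn x)%N by rewrite truncn_gt0.
have [||hy _ _] := IH (x / (8 * 1119)%:R).
- rewrite truncn_divn//; last exact: le_trans x1.
  exact: leq_trans (ltn_Pdiv _ T0) xn.
- by rewrite (ler_pdivlMr _ _ K0) mul1r.
- have A := logsum1_tail_head x8 g01 (hg 1119%N isT) hq hy.
  have B := logsum1_tail_middle x8.
  have N0 : 1119%:R <= x by apply: le_trans x8; rewrite ler_nat.
  have E := logsum1_remainder 1119 x1.
  rewrite (big_cat_nat _ (n := (Num.truncn x %/ (8 * 1119)).+1))//= in E; last first.
    by rewrite ltnS leq_div.
  (* With the 1/10^5 of [logsumN1_1119] the total is below 299/10^5. *)
  have : `|logsum 1 x - logsumN 1 1119| <= 90 / 10 ^+ 5 + 395 / 10 ^+ 6 * (525 / 100).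
    rewrite -[logsumN 1 1119](_ : capped 1119 x = _); last by rewrite /capped ltNge N0.
    by rewrite E; apply: (le_trans (ler_normD _ _)); exact: lerD.
  have := @logsumN1_1119 R; rewrite !ler_norml => /andP[a1 a2] /andP[b1 b2].
  have x5 : 5 <= x by apply: le_trans x8; rewrite ler_nat.
  split; [|by rewrite ltNge x5|move=> _].
    by clear -a1 a2 b1 b2; apply/andP; split; lra.
  by clear -a1 a2 b1 b2; lra.
Qed.

End Core.

(** * Higher powers, exponents and coprimality conditions *)

Section Powers.
Variable R : realType.
Implicit Types (x t u : R).
Local Notation mu := (moebiusR R).

(** The right end T + 1 is included because the new term vanishes there, its exponent being
    positive. *)
Lemma logsumS_cell k (T : nat) x : (0 < T)%N -> T%:R <= x <= T.+1%:R ->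
  logsum k.+1 x = \sum_(1 <= j < T.+1) mu j / j%:R * (ln x - ln j%:R) ^+ k.+1.
Proof.
move=> T0 /andP[Tx xT]; have TR : 0 < T%:R :> R by rewrite ltr0n.
have x0 : 0 < x by lra.
have E n : \sum_(1 <= j < n) mu j / j%:R * ln (x / j%:R) ^+ k.+1 =
  \sum_(1 <= j < n) mu j / j%:R * (ln x - ln j%:R) ^+ k.+1.
  rewrite big_nat [RHS]big_nat; apply: eq_bigr => j /andP[j0 _].
  by rewrite ln_div ?posrE ?ltr0n.
rewrite /logsum E; case: (ltP x T.+1%:R) => xT'.
  by rewrite (_ : Num.truncn x = T)//; apply: truncn_def; rewrite Tx.
have -> : x = T.+1%:R by apply/eqP; rewrite eq_le xT.
by rewrite natrK big_nat_recr//= subrr expr0n mulr0 addr0.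
Qed.

(* On a cell [T, T + 1] both terms are polynomials in ln x. *)
Lemma logsum_growth k (a b X : R) :
  (forall x, 1 <= x -> x < X -> 0 <= a * k.+1%:R * ln x ^+ k + b * k.+2%:R * logsum k.+1 x) ->
  forall x, 1 <= x -> x <= X -> 0 <= a * ln x ^+ k.+1 + b * logsum k.+2 x.
Proof.
move=> H.
have step (T : nat) x : (0 < T)%N -> T%:R <= x <= T.+1%:R -> x <= X ->
    0 <= a * ln T%:R ^+ k.+1 + b * logsum k.+2 T%:R ->
    0 <= a * ln x ^+ k.+1 + b * logsum k.+2 x.
  move=> T0 /andP[Tx xT] xX h0; have TR : 0 < T%:R :> R by rewrite ltr0n.
  have [->//|Tnx] := eqVneq x T%:R.
  have {}Tx : T%:R < x by rewrite lt_neqAle eq_sym Tnx.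
  have x0 : 0 < x by lra.
  pose p : {poly R} := a *: 'X^(k.+1) +
     b *: \sum_(1 <= j < T.+1) (mu j / j%:R) *: ('X - (ln j%:R)%:P) ^+ k.+2.
  have pE y : T%:R <= y <= T.+1%:R -> a * ln y ^+ k.+1 + b * logsum k.+2 y = p.[ln y].
    move=> yT; rewrite (logsumS_cell _ T0 yT) /p !hornerE horner_sum; congr (_ + _ * _).
    by apply: eq_bigr => j _; rewrite !hornerE.
  have lnlt : ln T%:R < ln x by rewrite ltr_ln ?posrE.
  (* The derivative of p at [c] is the expression of the hypothesis at [expR c], a point of the same
     cell below X. *)
  have [c] := polyrcf.poly_mvt p lnlt.
  rewrite in_itv /= => /andP[Tc cx] pc.
  have y1 : T%:R < expR c by rewrite -ltr_ln ?posrE ?expR_gt0// expRK.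
  have y2 : expR c < x by rewrite -ltr_ln ?posrE ?expR_gt0// expRK.
  have yT : T%:R <= expR c <= T.+1%:R by apply/andP; split; lra.
  have h1 : 1 <= expR c by apply: le_trans (ltW y1); rewrite ler1n.
  have := H _ h1 (lt_le_trans y2 xX).
  rewrite (logsumS_cell _ T0 yT) expRK => Hc.
  suff Hp : p^`().[c] = a * k.+1%:R * c ^+ k + b * k.+2%:R * \sum_(1 <= j < T.+1) mu j / j%:R * (c - ln j%:R) ^+ k.+1.
    rewrite -Hp in Hc; rewrite pE ?(ltW Tx)//; rewrite pE ?lexx ?ler_nat//= in h0.
    have : 0 <= p.[ln x] - p.[ln T%:R] by rewrite pc mulr_ge0// subr_ge0 ltW.
    by rewrite subr_ge0; exact: le_trans.
  rewrite /p derivD !derivZ derivXn linear_sum /= hornerD !hornerZ hornerMn hornerXn horner_sum.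
  congr (_ + _); first by rewrite -mulr_natl; ring.
  rewrite -mulrA; congr (_ * _); rewrite mulr_sumr; apply: eq_bigr => j _.
  rewrite derivZ deriv_exp derivXsubC mul1r hornerZ hornerMn horner_exp hornerXsubC.
  by rewrite -mulr_natl /=; ring.
have nat_ge0 (n : nat) : (0 < n)%N -> n%:R <= X -> 0 <= a * ln n%:R ^+ k.+1 + b * logsum k.+2 n%:R.
  elim: n => // n IH _ nX; have [->|n0] := posnP n.
    by rewrite /logsum truncn1 big_nat1 divr1 ln1 !expr0n !mulr0 addr0.
  have nX' : n%:R <= X by apply: le_trans nX; rewrite ler_nat.
  by apply: (step n) => //; [rewrite ler_nat leqnSn lexx|exact: IH].
move=> x x1 xX; have /andP[Tx xT] : (Num.truncn x)%:R <= x < (Num.truncn x).+1%:R by apply: truncn_itv; lra.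
have T0 : (0 < Num.truncn x)%N by rewrite truncn_gt0.
apply: (step (Num.truncn x)) => //; first by rewrite Tx ltW.
by apply: nat_ge0 => //; exact: le_trans xX.
Qed.

Lemma logsum_ge0 k x : 1 <= x -> 0 <= logsum k.+1 x.
Proof.
elim: k x => [|k IH] x x1; first by have [/andP[]] := logsum1_bounds x1.
have h y : 1 <= y -> y < x -> 0 <= 0 * k.+1%:R * ln y ^+ k + 1 * k.+2%:R * logsum k.+1 y.
  by move=> y1 _; rewrite !mul0r add0r mul1r mulr_ge0// IH.
by have := logsum_growth h x1 (lexx x); rewrite mul0r add0r mul1r.
Qed.

Lemma sum_nat_real (T : nat) : \sum_(1 <= n < T.+1) n%:R = T%:R * (T%:R + 1) / 2 :> R.
Proof.
elim: T => [|T IH]; first by rewrite big_geq// !mul0r.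
by rewrite big_nat_recr//= IH -natr1; field.
Qed.

(** Inverting the expansion gives [logsum 2 x / 2] + g L(x) + c [logsum 0 x] + error = log x. As
    L(x) >= 9/10, the term g L(x) is at least 0.504 and outweighs the next two, at most 1/12 and
    3/10 in size. *)
Lemma logsum2_large x : 5 <= x -> logsum 2 x <= 2 * ln x.
Proof.
move=> x5; have x1 : 1 <= x by lra.
have x0 : 0 < x by lra.
have [g [c [hg /andP[c0 c1] hq]]] := harmonic_log_expansion R.
have g56 : 56 / 100 <= g.
  have /andP[a _] := hg 1%N isT; move: a; rewrite /gamma_up /harm big_nat1 ln1 add0r invr1.
  rewrite (_ : 6 * 1%:R * (1%:R + 1) = 12); last by lra.
  by have := ln2_le R; lra.
have E := moebius_inversion (@ln R) x1.
have W v : \sum_(1 <= m < (Num.truncn v).+1) m%:R^-1 * ln (v / m%:R) =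
    (ln v ^+ 2 / 2 + g * ln v + c) + hlog_err g c v by rewrite -/(hlog_sum v) /hlog_err addrC subrK.
have {}E : logsum 2 x / 2 + g * logsum 1 x + c * logsum 0 x
   + \sum_(1 <= n < (Num.truncn x).+1) mu n / n%:R * hlog_err g c (x / n%:R) = ln x.
  rewrite -[RHS]E /logsum !mulr_sumr mulr_suml -!big_split /=; apply: eq_bigr => n _.
  by rewrite W expr0 expr1; move: (mu n / n%:R) (hlog_err _ _ _) => u v; field.
(* [hlog_err_bound] with K = 1 has the constant 1/2, so the sum is at most (1 + 1/x)/4, which is
   3/10 at x = 5. *)
have Q : `|\sum_(1 <= n < (Num.truncn x).+1) mu n / n%:R * hlog_err g c (x / n%:R)| <= 3 / 10.
  apply: (le_trans (ler_norm_sum _ _ _)).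
  apply: (@le_trans _ _ (\sum_(1 <= n < (Num.truncn x).+1) (2 * x ^+ 2)^-1 * n%:R)).
    rewrite big_nat [leRHS]big_nat ler_sum// => n /andP[n0 nT].
    have nR : 0 < n%:R :> R by rewrite ltr0n.
    have v1 : 1%:R <= x / n%:R by rewrite ler_pdivlMr// mul1r -truncn_ge_nat ?(ltW x0).
    have h := @hlog_err_bound R g c 1 _ isT v1 (hq _ v1).
    rewrite 2!normrM normfV [`|n%:R|]ger0_norm ?(ltW nR)//.
    apply: (@le_trans _ _ (1 / n%:R * ((2%:R / 1%:R) ^+ 2 / 8 / (x / n%:R) ^+ 2))).
      apply: ler_pM => //; rewrite ?divr_ge0 ?(ltW nR)//.
      by rewrite ler_pM2r ?invr_gt0// moebiusR_norm.
    by rewrite le_eqVlt; apply/orP; left; apply/eqP; field; rewrite !gt_eqF.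
  rewrite -mulr_sumr sum_nat_real.
  have Tx : (Num.truncn x)%:R <= x by rewrite truncn_le ltW.
  rewrite mulrC ler_pdivrMr ?mulr_gt0 ?exprn_gt0//.
  move: ((Num.truncn x)%:R : R) (ler0n R (Num.truncn x)) Tx => T T0 Tx.
  have : T * (T + 1) <= x * (x + 1) by apply: ler_pM => //; lra.
  have : 5 * x <= x * x by rewrite ler_pM2r.
  rewrite expr2; lra.
have [_ _ /(_ x5) L] := logsum1_bounds x1.
have S0 := @logsum0_le1 R x.
have h1 : 56 / 100 * (9 / 10) <= g * logsum 1 x by apply: ler_pM => //; lra.
have h2 : `|c * logsum 0 x| <= 1 / 12 * 1 by rewrite normrM; apply: ler_pM => //; rewrite ger0_norm.
move: Q h2; rewrite !ler_norml => /andP[q1 q2] /andP[r1 r2]; lra.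
Qed.

(** Induction by [logsum_growth]. The base case integrates L <= 1 below 5 and is [logsum2_large]
    from 5 on. *)
Lemma logsum_le k x : 1 <= x -> logsum k.+2 x <= k.+2%:R * ln x ^+ k.+1.
Proof.
elim: k x => [|k IH] x x1.
  have [x5|x5] := ltP x 5; last by rewrite expr1; exact: logsum2_large.
  have h y : 1 <= y -> y < x -> 0 <= 2 * 1%:R * ln y ^+ 0 + -1 * 2%:R * logsum 1 y.
    move=> y1 yx; have [_ + _] := logsum1_bounds y1; move=> /(_ (lt_trans yx x5)).
    by rewrite expr0; lra.
  by have := logsum_growth h x1 (lexx x); rewrite mulN1r subr_ge0.
have h y : 1 <= y -> y < x ->
    0 <= k.+3%:R * k.+2%:R * ln y ^+ k.+1 + -1 * k.+3%:R * logsum k.+2 y.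
  move=> y1 _; have := IH y y1; rewrite -subr_ge0 => h.
  by rewrite mulN1r mulNr -mulrA -mulrBr mulr_ge0.
by have := logsum_growth h x1 (lexx x); rewrite mulN1r subr_ge0.
Qed.

(** * Real exponents, by expanding the exponential *)

Section Sigma.
Variables (k : nat) (C s x : R).
Hypotheses (k0 : (0 < k)%N) (C0 : 0 <= C) (s0 : 0 <= s) (x1 : 1 <= x).
Hypothesis SC : forall j, 0 <= logsum (k + j) x <= C * (k + j)%:R * ln x ^+ (k + j).-1.

(** Here s = sigma - 1, and the exponential series of (x/n)^s is cut off after J terms. *)
Let partial J := \sum_(1 <= n < (Num.truncn x).+1)
  mu n / n%:R * ln (x / n%:R) ^+ k * series (exp_coeff (s * ln (x / n%:R))) J.

Lemma partialE J : partial J = \sum_(0 <= j < J) s ^+ j / j`!%:R * logsum (k + j) x.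
Proof.
rewrite /partial /series /=; under eq_bigr do rewrite mulr_sumr.
rewrite exchange_big_nat/=; apply: eq_bigr => j _; rewrite /logsum mulr_sumr.
by apply: eq_bigr => n _; rewrite /exp_coeff /= exprD exprMn; ring.
Qed.

(** Put a_j = (s log x)^j / j!. The upper bound comes from the sum of (k + j) a_j, where j a_j = s
    log x a_(j-1), and partial sums of the a_j are at most exp(s log x). *)
Lemma partial_bounds J :
  0 <= partial J <= C * (k%:R + s * ln x) * ln x ^+ k.-1 * expR (s * ln x).
Proof.
have l0 : 0 <= ln x by apply: ln_ge0.
have sl0 : 0 <= s * ln x by rewrite mulr_ge0.
have ser_le n : series (exp_coeff (s * ln x)) n <= expR (s * ln x).
  apply: nondecreasing_cvgn_le; last exact: is_cvg_series_exp_coeff.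
  by apply: nondecreasing_series => i _ _; exact: exp_coeff_ge0.
rewrite partialE; apply/andP; split.
  apply: sumr_ge0 => j _; rewrite mulr_ge0 ?divr_ge0 ?exprn_ge0//.
  by case/andP: (SC j).
apply: (@le_trans _ _ (C * ln x ^+ k.-1 * (k%:R * series (exp_coeff (s * ln x)) J
   + s * ln x * series (exp_coeff (s * ln x)) J.-1))).
  apply: (@le_trans _ _ (\sum_(0 <= j < J) C * ln x ^+ k.-1 * ((k + j)%:R * exp_coeff (s * ln x) j))).
    apply: ler_sum => j _; case/andP: (SC j) => _ h.
    apply: (le_trans (ler_wpM2l _ h)); first by rewrite divr_ge0 ?exprn_ge0.
    rewrite (_ : (k + j).-1 = (k.-1 + j)%N); last by move: k0; lia.
    by rewrite /exp_coeff /= exprD exprMn le_eqVlt; apply/orP; left; apply/eqP; ring.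
  rewrite -mulr_sumr le_eqVlt; apply/orP; left; apply/eqP; congr (_ * _).
  under eq_bigr do rewrite natrD mulrDl.
  rewrite big_split /= -mulr_sumr; congr (_ + _).
  case: J => [|J]; first by rewrite /series /= !big_geq// mulr0.
  rewrite big_nat_recl//= mul0r add0r /series /= mulr_sumr; apply: eq_bigr => j _.
  rewrite /exp_coeff /= factS natrM exprS; field.
  by rewrite pnatr_eq0 -lt0n fact_gt0 addrC natr1 pnatr_eq0.
have cl : 0 <= C * ln x ^+ k.-1 by rewrite mulr_ge0 ?exprn_ge0.
have -> : C * (k%:R + s * ln x) * ln x ^+ k.-1 * expR (s * ln x) =
  C * ln x ^+ k.-1 * (k%:R * expR (s * ln x) + s * ln x * expR (s * ln x)) by ring.
by rewrite ler_wpM2l// lerD// ler_wpM2l.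
Qed.

(** Let J tend to infinity in [partial_bounds], the sum over n being finite. The factor exp(s log x)
    cancels against x^(-s). *)
Lemma sigma_bounds :
  0 <= \sum_(1 <= n < (Num.truncn x).+1) mu n / (n%:R `^ (1 + s)) * ln (x / n%:R) ^+ k
    <= C * (k%:R + s * ln x) * ln x ^+ k.-1.
Proof.
have x0 : 0 < x := lt_le_trans ltr01 x1.
set B := C * _ * _.
have E : \sum_(1 <= n < (Num.truncn x).+1) mu n / (n%:R `^ (1 + s)) * ln (x / n%:R) ^+ k =
  expR (- (s * ln x)) * \sum_(1 <= n < (Num.truncn x).+1)
     mu n / n%:R * ln (x / n%:R) ^+ k * expR (s * ln (x / n%:R)).
  rewrite mulr_sumr big_nat [RHS]big_nat; apply: eq_bigr => n /andP[n0 _].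
  have nR : 0 < n%:R :> R by rewrite ltr0n.
  have -> : n%:R `^ (1 + s) = n%:R * expR (s * ln n%:R).
    rewrite powRD; last by rewrite (gt_eqF nR) implybT.
    by rewrite powRr1 ?(ltW nR)// /powR (gt_eqF nR).
  rewrite ln_div ?posrE// [s * (_ - _)]mulrBr expRD expRN.
  by rewrite (expRN (s * ln n%:R)); field; rewrite !gt_eqF ?expR_gt0.
have cv : (partial J @[J --> \oo] --> \sum_(1 <= n < (Num.truncn x).+1)
     mu n / n%:R * ln (x / n%:R) ^+ k * expR (s * ln (x / n%:R)))%classic.
  apply: cvg_big => [|n _]; first exact: add_continuous.
  by apply: cvgMl_tmp; exact: is_cvg_series_exp_coeff.
rewrite E mulrC; set S := \sum_(_ <= _ < _) _ in cv *.
have S0 : 0 <= S.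
  rewrite -(cvg_lim _ cv)//; apply: limr_ge; first by apply/cvg_ex; exists S.
  by apply: nearW => J; case/andP: (partial_bounds J).
have S1 : S <= B * expR (s * ln x).
  rewrite -(cvg_lim _ cv)//; apply: limr_le; first by apply/cvg_ex; exists S.
  by apply: nearW => J; case/andP: (partial_bounds J).
rewrite mulr_ge0 ?expR_ge0//= expRN ler_pdivrMr ?expR_gt0//.
Qed.

End Sigma.

(** * Coprimality conditions, one prime at a time *)

Section Coprime.
Variables (k : nat) (sigma : R) (B : R -> R).
Hypothesis sigma1 : 1 <= sigma.

Definition term n x : R := mu n / (n%:R `^ sigma) * ln (x / n%:R) ^+ k.

Definition Msum (ps : seq nat) x : R :=
  \sum_(1 <= n < (Num.truncn x).+1 | all (fun p => ~~ (p %| n)%N) ps) term n x.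

(** In [Msum ps x] the multiples of p are n = p m; the term vanishes if p divides m, and otherwise
    is -p^(-sigma) times the term of m at x/p. *)
Lemma Msum_cons p ps x : 0 <= x -> prime p -> all prime ps -> p \notin ps ->
  Msum (p :: ps) x = Msum ps x + (p%:R `^ sigma)^-1 * Msum (p :: ps) (x / p%:R).
Proof.
move=> x0 pp aps pps; have p0 := prime_gt0 pp.
have pR : 0 < p%:R :> R by rewrite ltr0n.
rewrite [Msum ps x](bigID (fun n => p %| n)%N) /= addrC.
under eq_bigl do rewrite andbC.
rewrite -[LHS]addr0 -addrA; congr (_ + _).
under eq_bigl do rewrite andbC.
rewrite sum_multiples// /Msum truncn_divn// mulr_sumr.
rewrite (bigID (fun n => p %| n)%N) /= [X in X + _ + _]big_nat_cond [X in X + _ + _]big1 ?add0r; last first.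
  move=> m /andP[/andP[m0 _] /andP[_ pm]].
  by rewrite /term /moebiusR moebius_psqr// !mul0r.
apply/esym/eqP; rewrite addr_eq0 -sumrN; apply/eqP.
rewrite big_nat_cond [RHS]big_nat_cond; apply: eq_big => [m|m].
  case: (boolP (1 <= m < (Num.truncn x %/ p).+1)%N) => //= mr.
  rewrite andbC; apply: andb_id2l => pm; apply: eq_in_all => r rps.
  have pr : prime r by move/allP: aps => /(_ r rps).
  rewrite Euclid_dvdM// (dvdn_prime2 pr pp); case: eqP => // rp.
  by move: pps; rewrite -rp rps.
move=> /andP[/andP[m0 _] /andP[_ pm]]; have mR : 0 < m%:R :> R by rewrite ltr0n.
rewrite /term /moebiusR moebius_pmul// ?prime_coprime// rmorphN /= natrM powRM ?(ltW mR) ?(ltW pR)//.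
by rewrite !mulNr !invfM !mulrA; congr (- _); ring.
Qed.

Hypothesis B0 : forall x, 1 <= x -> 0 <= B x.
Hypothesis B_le : forall x y, 1 <= x -> x <= y -> B x <= B y.
Hypothesis MB : forall x, 1 <= x -> 0 <= Msum [::] x <= B x.

Lemma Msum_lt1 ps x : x < 1 -> Msum ps x = 0.
Proof.
move=> x1; rewrite /Msum (_ : Num.truncn x = 0%N) ?big_geq//.
by apply/eqP; rewrite -leqn0 leqNgt truncn_gt0 -ltNge.
Qed.

(** Induction on the list and, for each new prime, on the integer part of x. Since sigma >= 1,
    p^(-sigma) <= 1/p, and the constant closes up because 1 + (1/p) p/(p - 1) = p/(p - 1). *)
Lemma Msum_bounds ps x : uniq ps -> all prime ps -> 1 <= x ->
  0 <= Msum ps x <= \prod_(p <- ps) (p%:R / p.-1%:R) * B x.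
Proof.
elim: ps x => [|p ps IH] x; first by rewrite big_nil mul1r => _ _; exact: MB.
move=> /andP[pps ups] /andP[pp aps]; rewrite big_cons.
set Q := \prod_(_ <- ps) _ in IH *.
have Q0 : 0 <= Q by apply: prodr_ge0 => r _; rewrite divr_ge0.
have p1 := prime_gt1 pp.
have pR : 1 < p%:R :> R by rewrite (ltr_nat _ 1).
have pE : p.-1%:R = p%:R - 1 :> R by rewrite -subn1 natrB// ltnW.
have [n] := ubnP (Num.truncn x); elim: n x => // n IHn x xn x1.
have x0 : 0 <= x by apply: le_trans x1.
rewrite Msum_cons//; have /andP[a0 a1] := IH x ups aps x1.
have Bx := B0 x1.
have ip : 0 <= (p%:R `^ sigma)^-1 <= p%:R^-1.
  rewrite invr_ge0 powR_ge0/= lef_pV2 ?posrE ?powR_gt0 ?ltr0n ?prime_gt0//.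
  by have := @ler_powR R p%:R (ltW pR) 1 sigma sigma1; rewrite powRr1.
case/andP: ip => ip0 ip1.
have T0 : (0 < Num.truncn x)%N by rewrite truncn_gt0.
have : 0 <= Msum (p :: ps) (x / p%:R) <= p%:R / p.-1%:R * Q * B x.
  have [xp|xp] := ltP (x / p%:R) 1.
    by rewrite (Msum_lt1 _ xp) lexx mulr_ge0// mulr_ge0// divr_ge0.
  have h : (Num.truncn (x / p%:R) < n)%N.
    rewrite truncn_divn ?prime_gt0//.
    by apply: leq_trans (ltn_Pdiv p1 T0) _; rewrite -ltnS.
  have /andP[-> /le_trans] := IHn _ h xp; apply.
  rewrite ler_wpM2l// ?mulr_ge0 ?divr_ge0// B_le//.
  by rewrite ler_pdivrMr ?ler_peMr ?(ltW pR)// (lt_trans ltr01).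
move=> /andP[b0 b1]; apply/andP; split; first by rewrite addr_ge0// mulr_ge0.
have h := ler_pM ip0 b0 ip1 b1.
apply: (le_trans (lerD a1 h)).
rewrite le_eqVlt; apply/orP; left; apply/eqP; rewrite pE; field.
by rewrite !gt_eqF ?subr_gt0// (lt_trans ltr01).
Qed.

End Coprime.

Lemma prod_primes_totient q : (0 < q)%N ->
  \prod_(p <- primes q) (p%:R / p.-1%:R) = q%:R / (totient q)%:R :> R.
Proof.
move=> q0; rewrite totientE// {2}(prod_prime_decomp q0) prime_decompE big_map.
rewrite !natr_prod -prodfV -big_split /=; apply: eq_big_seq => p pq.
have pp : prime p by move: pq; rewrite mem_primes => /and3P[].
have lp : (0 < logn p q)%N by rewrite logn_gt0.
rewrite -(prednK lp) /=; move: (logn p q).-1 => e; rewrite natrM !natrX exprS; field.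
apply/andP; split; first by rewrite expf_neq0// pnatr_eq0 -lt0n prime_gt0.
by rewrite pnatr_eq0 -lt0n -ltnS prednK ?prime_gt0 ?prime_gt1.
Qed.

Lemma moebius_log_sumE q k (sigma x : R) : (0 < q)%N ->
  moebius_log_sum q k sigma x = Msum k sigma (primes q) x.
Proof.
move=> q0; rewrite /moebius_log_sum /Msum big_nat_cond [RHS]big_nat_cond.
apply: eq_bigl => n; case: (boolP (1 <= n < _)%N) => //= /andP[n0 _].
rewrite coprime_has_primes// -all_predC; apply: eq_in_all => p /=.
by rewrite !mem_primes n0 => /and3P[-> _ _].
Qed.

(** The hypothesis covers all exponents k + j because the expansion of the exponential raises the
    power of the logarithm by every j. *)
Lemma moebius_log_sum_bounds q k (C sigma x : R) : (0 < q)%N -> (0 < k)%N ->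
  0 <= C -> 1 <= sigma -> 1 <= x ->
  (forall j y, 1 <= y -> logsum (k + j) y <= C * (k + j)%:R * ln y ^+ (k + j).-1) ->
  0 <= moebius_log_sum q k sigma x <=
    q%:R / (totient q)%:R * (C * (k%:R + (sigma - 1) * ln x) * ln x ^+ k.-1).
Proof.
move=> q0 k0 C0 sigma1 x1 H.
rewrite moebius_log_sumE// -prod_primes_totient//.
have s0 : 0 <= sigma - 1 by rewrite subr_ge0.
have l0 y : 1 <= y -> 0 <= ln y := @ln_ge0 R y.
apply: (@Msum_bounds k sigma (fun y => C * (k%:R + (sigma - 1) * ln y) * ln y ^+ k.-1)) => //.
- by move=> y y1; rewrite mulr_ge0 ?exprn_ge0 ?l0// mulr_ge0// addr_ge0// mulr_ge0// l0.
- move=> y z y1 yz.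
  have yz' : ln y <= ln z by rewrite ler_ln ?posrE//; apply: lt_le_trans ltr01 _ => //; exact: le_trans yz.
  have ly := l0 _ y1.
  apply: ler_pM.
  + by rewrite mulr_ge0// addr_ge0// mulr_ge0.
  + by rewrite exprn_ge0.
  + by rewrite ler_wpM2l// lerD2l ler_wpM2l.
  + by rewrite lerXn2r// nnegrE (le_trans ly).
- move=> y y1; have := @sigma_bounds k C (sigma - 1) y k0 C0 s0 y1.
  rewrite addrC subrK; apply => j; rewrite H// andbT.
  by case: (k) k0 => // k' _; rewrite addSn; exact: logsum_ge0.
- exact: primes_uniq.
- by apply/allP => p; rewrite mem_primes => /and3P[].
Qed.

End Powers.

Theorem theorem1p1 (R : realType) (q k : nat) (sigma X : R)
    (hq : (0 < q)%N) (hk : (1 <= k)%N) (hsigma : 1 <= sigma) (hX : 1 <= X) :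
  (0 <= moebius_log_sum q k sigma X
     <= (1 + 303 / 10 ^+ 5) * (q%:R / (totient q)%:R)
        * (k%:R + (sigma - 1) * ln X) * ln X ^+ k.-1)
  /\ (k <> 1%N ->
      moebius_log_sum q k sigma X
        <= q%:R / (totient q)%:R
           * (k%:R + (sigma - 1) * ln X) * ln X ^+ k.-1).
Proof.
have C1 : 1 <= 1 + 303 / 10 ^+ 5 :> R by lra.
have S2 j y : 1 <= y -> logsum j.+2 y <= j.+2%:R * ln y ^+ j.+1 := @logsum_le R j y.
split.
  have := @moebius_log_sum_bounds R q k (1 + 303 / 10 ^+ 5) sigma X hq hk (le_trans ler01 C1) hsigma hX.
  rewrite (_ : q%:R / _ * _ = (1 + 303 / 10 ^+ 5) * (q%:R / (totient q)%:R)
    * (k%:R + (sigma - 1) * ln X) * ln X ^+ k.-1); last by ring.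
  apply=> j y y1.
  have l0 := ln_ge0 y1.
  (* Only the exponent 1 uses 1.00303; the higher ones satisfy the bound with constant 1. *)
  case: (k + j)%N (leq_trans hk (leq_addr j k)) => // -[_|i _].
    by rewrite /= expr0 !mulr1; have [/andP[]] := logsum1_bounds y1.
  apply: (le_trans (S2 i y y1)); rewrite -mulrA -[leLHS]mul1r ler_wpM2r//.
  by rewrite mulr_ge0 ?exprn_ge0.
move=> k1; have k2 : (2 <= k)%N by case: (k) hk k1 => [|[]].
have H := @moebius_log_sum_bounds R q k 1 sigma X hq hk ler01 hsigma hX.
(* For k >= 2 the exponent k + j is never 1. *)
have Q (j : nat) (y : R) : 1 <= y ->
    logsum (k + j) y <= 1 * (k + j)%:R * ln y ^+ (k + j).-1.
  move=> y1; rewrite mul1r.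
  case: (k + j)%N (leq_trans k2 (leq_addr j k)) => // -[//|i _].
  exact: S2.
by have := H Q; rewrite (mul1r (k%:R + _)) mulrA => /andP[].
Qed.
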